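(* Let $A=(A(i,j),\,0\le i,j\le n-1)$ be an irreducible, aperiodic $0$-$1$ matrix, let $\phi\colon\Sigma_A^+\to\mathbb{R}$ be a function with summable variation, and let $\mathcal{G}$ be a countable, discrete group with finite conjugacy classes. For every continuous map $\psi\colon\Sigma_A^+\to\mathcal{G}$ there exists a continuous map $h\colon\Sigma_A^+\to\mathcal{G}$ such that the Gibbs measure $\mu_\phi$ is ergodic under the equivalence relation $S_A^{\psi'+}$, where $$\psi'(x)=h(x)\,\psi(x)\,h(\sigma(x))^{-1}\qquad(x\in\Sigma_A^+).$$ Moreover, the measure $\mu_\phi$ is ergodic under the original relation $S_A^{\psi+}$ if and only if $S_A^{\psi+}$ is topologically transitive.
   Context: $\Sigma_A^+=\{x=(x_k)_{k\ge0}\in\{0,\dots,n-1\}^{\mathbb{N}}: A(x_k,x_{k+1})=1\ \forall k\ge0\}$ is the one-sided shift of finite type, $\sigma(x)_k=x_{k+1}$ the one-sided shift, and $R_A^+=\{(x,x')\in\Sigma_A^+\times\Sigma_A^+: x_k=x'_k\text{ for all sufficiently large }k\}$ its Gibbs relation. For an equivalence relation $R$ with countable classes on a standard Borel space $X$, the saturation of $B$ is $R(B)=\{x':(x,x')\in R\text{ for some }x\in B\}$. A probability measure $\mu$ is quasi-invariant under $R$ if $\mu(R(B))=0$ whenever $\mu(B)=0$, and ergodic under $R$ if it is quasi-invariant and for every Borel $B$ either $\mu(R(B))=0$ or $\mu(X\smallsetminus R(B))=0$. If $\mu$ is quasi-invariant, its Radon-Nikodym derivative is a Borel map $\rho_\mu\colon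 R\to(0,\infty)$ with $\rho_\mu(x,x')\rho_\mu(x',x'')=\rho_\mu(x,x'')$ and $\rho_\mu(Wx,x)=\frac{d\mu W}{d\mu}(x)$ $\mu$-a.e. for every Borel automorphism $W$ of $X$ with $(x,Wx)\in R$ for all $x$. A relation on a topological space is topologically transitive if some equivalence class is dense. For continuous $\phi\colon\Sigma_A^+\to\mathbb{R}$ put $\omega_0(\phi)=\max|\phi(x)-\phi(x')|$ and $\omega_k(\phi)=\max\{|\phi(x)-\phi(x')|:x_l=x'_l\text{ for }0\le l<k\}$, $k\ge1$; $\phi$ has summable variation if $\sum_{k\ge0}\omega_k(\phi)<\infty$. A Borel probability measure $\mu$ on $\Sigma_A^+$ is a Gibbs measure of $\phi$ if it is quasi-invariant under $R_A^+$ and (up to a $\mu$-null set) $\log\rho_\mu(x,x')=\sum_{k\ge0}(\phi(\sigma^k x)-\phi(\sigma^k x'))$ for $(x,x')\in R_A^+$. For $A$ irreducible and aperiodic and $\phi$ of summable variation there is exactly one Gibbs measure of $\phi$, denoted $\mu_\phi$. ''Finite conjugacy classes'' means $|\{hgh^{-1}:h\in\mathcal{G}\}|<\infty$ for every $g\in\mathcal{G}$. For a continuous map $\psi\colon\Sigma_A^+\to\mathcal{G}$ and $(x,x')\in R_A^+$ put $$\mathcal{J}_+^\psi(x,x')=\lim_{K\to\infty}\psi(x)\psi(\sigma x)\cdots\psi(\sigma^K x)\,\bigl(\psi(x')\psi(\sigma x')\cdots\psi(\sigma^K x')\bigr)^{-1}$$ (the expression is eventually constant in $K$), and $$S_A^{\psi+}=\{(x,x')\in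 R_A^+:\mathcal{J}_+^\psi(x,x')=1_{\mathcal{G}}\},$$ where $1_{\mathcal{G}}$ is the identity of $\mathcal{G}$. *)

(* Defs.v *)
From HB Require Import structures.
From mathcomp Require Import all_boot all_order all_algebra.
From mathcomp Require Import all_classical all_reals all_analysis.

Set Implicit Arguments.
Unset Strict Implicit.
Unset Printing Implicit Defensive.

Import Order.TTheory GRing.Theory Num.Theory.
Import numFieldNormedType.Exports.

Local Open Scope classical_set_scope.
Local Open Scope ring_scope.

Section relations.
Context d (T : measurableType d) (R : realType).
Implicit Types (E : set (T * T)) (mu : probability T R).

Definition saturation E (B : set T) : set T :=
  [set x' | exists2 x, B x & E (x, x')].

Definition quasi_invariant E mu :=
  forall B, measurable B -> mu B = 0%E -> mu (saturation E B) = 0%E.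

Definition ergodic E mu :=
  quasi_invariant E mu /\
  forall B, measurable B ->
    mu (saturation E B) = 0%E \/ mu (~` saturation E B) = 0%E.

(* [V] is the inverse of the Borel automorphism [W], so that
   [distribution mu V B = mu (V @^-1` B) = mu (W @` B)] is the measure
   [mu W] of which the derivative is taken.  The values of [rho] outside [E]
   are irrelevant. *)
Definition is_RN_derivative E mu (rho : T * T -> R) :=
  [/\ measurable_fun E rho,
      forall p, E p -> 0 < rho p,
      forall x x' x'', E (x, x') -> E (x', x'') ->
        rho (x, x') * rho (x', x'') = rho (x, x'')
    & forall W V : {mfun T >-> T}, cancel W V -> cancel V W ->
        (forall x, E (x, W x)) ->
        ae_eq mu setT
          (Radon_Nikodym (charge_of_finite_measure (distribution mu V)) mu)
          (fun x => (rho (W x, x))%:E)].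

End relations.

Definition topologically_transitive (X : topologicalType) (E : set (X * X)) :=
  exists x, dense [set x' | E (x, x')].

Section matrices.
Variable n : nat.
Implicit Type A : 'M[bool]_n.

(* The entry [(i, j)] counts the allowed paths of length [k] from [i] to [j]. *)
Definition paths A k : 'M[nat]_n := map_mx nat_of_bool A ^+ k.

Definition irreducible_mx A :=
  forall i j, exists2 k, (0 < k)%N & (0 < paths A k i j)%N.

(* The gcd of the lengths of the closed paths through any state is 1. *)
Definition aperiodic_mx A :=
  forall i m, (forall k, (0 < k)%N -> (0 < paths A k i i)%N -> (m %| k)%N) ->
    m = 1%N.

Definition sft_set A : set {ptws nat -> discrete_topology 'I_n} :=
  [set x | forall k, A (x k) (x k.+1)].

End matrices.

Lemma sft_nonempty n (A : 'M[bool]_n.+1) :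
  irreducible_mx A -> exists x : sft_set A, True.
Proof.
move=> irrA; have next i : {j | A i j}.
  apply: cid; have [[//|k] _] := irrA i i; rewrite /paths exprS mxE.
  rewrite lt0n sum_nat_eq0 => /forallPn[j /=]; rewrite mxE => Aij.
  by exists j; case: (A i j) Aij => //; rewrite mul0r eqxx.
pose x k := iter k (fun i => sval (next i)) ord0.
have Ax : x \in sft_set A.
  by rewrite inE => k; rewrite /x iterS; case: (next _).
by exists (exist _ (x : {ptws nat -> discrete_topology 'I_n.+1}) Ax).
Qed.

(* Measurable types are inhabited in the library; the shift of finite type is
   therefore indexed by the proof that its matrix is irreducible. *)
Definition sft n (A : 'M[bool]_n.+1) (irrA : irreducible_mx A) : Type :=
  sft_set A.

Section sft.
Context n (A : 'M[bool]_n.+1) (irrA : irreducible_mx A).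

HB.instance Definition _ := Topological.copy (sft irrA) (sft_set A : Type).

HB.instance Definition _ :=
  isPointed.Build (sft irrA) (sval (cid (sft_nonempty irrA))).

HB.instance Definition _ := Measurable.copy (sft irrA)
  (g_sigma_algebraType (@open (sft irrA))).

Definition sft_coord (x : sft irrA) (k : nat) : 'I_n.+1 := sval x k.

Lemma sft_shift_subproof (x : sft irrA) :
  ((fun k => sft_coord x k.+1) : {ptws nat -> discrete_topology 'I_n.+1})
    \in sft_set A.
Proof. by rewrite inE => k; have := set_mem (svalP x); apply. Qed.

Definition sft_shift (x : sft irrA) : sft irrA :=
  exist (fun y => y \in sft_set A) _ (sft_shift_subproof x).

Definition gibbs_relation : set (sft irrA * sft irrA) :=
  [set p | exists N, forall k, (N <= k)%N -> sft_coord p.1 k = sft_coord p.2 k].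

End sft.

Arguments sft_shift {n A irrA}.
Arguments gibbs_relation {n A} irrA.

Section gibbs.
Context n (A : 'M[bool]_n.+1) (irrA : irreducible_mx A) (R : realType).
Implicit Types (phi : sft irrA -> R) (mu : probability (sft irrA) R).

Definition omega phi (k : nat) : \bar R :=
  ereal_sup [set (`|phi p.1 - phi p.2|)%:E | p in
    [set p | forall l, (l < k)%N -> sft_coord p.1 l = sft_coord p.2 l]].

Definition summable_variation phi :=
  continuous phi /\ (\sum_(0 <= k <oo) omega phi k < +oo)%E.

Definition gibbs_measure phi mu :=
  quasi_invariant (gibbs_relation irrA) mu /\
  exists2 rho, is_RN_derivative (gibbs_relation irrA) mu rho &
    \forall x \ae mu, forall x', gibbs_relation irrA (x, x') ->
      ln (rho (x, x')) =
      limn (series (fun k =>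
        phi (iter k sft_shift x) - phi (iter k sft_shift x'))).

End gibbs.

Definition finite_conjugacy_classes (G : groupType) :=
  forall g : G, finite_set [set (h * g * h^-1)%g | h in [set: G]].

Section skew.
Context n (A : 'M[bool]_n.+1) (irrA : irreducible_mx A) (G : groupType).
Implicit Type psi : sft irrA -> G.

Definition cocycle_seq psi (p : sft irrA * sft irrA) (K : nat) :
    discrete_topology G :=
  ((\big[*%g/1]_(0 <= k < K.+1) psi (iter k sft_shift p.1)) *
   (\big[*%g/1]_(0 <= k < K.+1) psi (iter k sft_shift p.2))^-1)%g.

(* The default value 1 is never used on [gibbs_relation]: see [cocycleP]. *)
Definition cocycle psi p : G :=
  xget 1%g [set g : discrete_topology G | cocycle_seq psi p @ \oo --> g].

Lemma cocycleP psi p : gibbs_relation irrA p ->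
  \forall K \near \oo, cocycle_seq psi p K = cocycle psi p.
Proof.
move=> [N pN].
have eqs k : (N <= k)%N -> iter k sft_shift p.1 = iter k sft_shift p.2.
  move=> Nk; have shiftE (x : sft irrA) l :
      sft_coord (iter k sft_shift x) l = sft_coord x (k + l).
    elim: k {Nk} l => // k IHk l.
    by rewrite iterS /sft_coord/= -/(sft_coord _ _) IHk addnS.
  apply: eq_sig_hprop => /=; first by move=> ? ? ?; exact: Prop_irrelevance.
  apply/funext => l; rewrite -!/(sft_coord _ _) !shiftE pN//.
  exact: leq_trans (leq_addr _ _).
have stab K : (N <= K)%N -> cocycle_seq psi p K = cocycle_seq psi p N.
  elim: K => [|K IHK]; first by rewrite leqn0 => /eqP ->.
  rewrite leq_eqVlt => /predU1P[->//|]; rewrite ltnS => NK.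
  rewrite -IHK// /cocycle_seq big_nat_recr//=.
  rewrite [in X in (_ * X)%g]big_nat_recr//=.
  by rewrite eqs ?(leq_trans NK)// invgM mulgA mulgK.
have dP (g : discrete_topology G) : cocycle_seq psi p @ \oo --> g <->
    \forall K \near \oo, cocycle_seq psi p K = g.
  split=> [/(_ [set g])|gE B Bg]; first by apply; exact: discrete_set1.
  by apply: filterS gE => K EK; rewrite /= EK; exact: nbhs_singleton.
have cv : cocycle_seq psi p @ \oo --> cocycle_seq psi p N.
  by apply/dP; exists N => // K /= /stab.
by apply/dP; exact: (@xgetI G 1%g
  [set g : discrete_topology G | cocycle_seq psi p @ \oo --> g] _ cv).
Qed.

Definition skew_relation psi : set (sft irrA * sft irrA) :=
  [set p | gibbs_relation irrA p /\ cocycle psi p = 1%g].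

End skew.

(* Main.v *)
(* Write psi_N(x) = psi(x) psi(s x) ... psi(s^(N-1) x), so that (x, x') lies in
   S^psi iff s^N x = s^N x' and psi_N(x) = psi_N(x') for some N, and choose r such
   that psi depends on the first r coordinates.  Fix an admissible word w of length
   r.  If E is a word leading from w back to w whose psi-product commutes with all
   values of psi, and F is any word leading from w to w, then the points E F y and
   F E y are S^psi-equivalent.  Moving E far to the right in this way, where it is
   invisible for a cylinder approximation of a set B invariant under the restriction
   of S^psi to the cylinder [w], shows as in the Hewitt-Savage zero-one law that B
   is, up to a null set, invariant under the exchange of any two such central words
   of equal length; the summable variation of phi bounds the distortion of mu under
   all these exchanges.  In a group with finite conjugacy classes some fixed power of
   every element commutes with the finitely many values of psi, so that any two words
   of equal length from w to w extend by a bounded amount to central ones.  Applied to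
   words on whose cylinders B, respectively its complement, has density close to one,
   this forces B to be null or conull in [w].

   Hence S^psi has finitely many ergodic components, each a union of cylinders of
   length r, and it is ergodic as soon as it links any two of these cylinders.
   Topological transitivity provides these links.  In general let h(x) be the inverse
   of the psi-product of a word of fixed length which extends x_0 ... x_(r-1) and ends
   at a fixed point: then psi' identifies the starting points of all these words. *)
Require Import Defs.
From HB Require Import structures.
From mathcomp Require Import all_boot all_order all_algebra.
From mathcomp Require Import zify ring lra.
From mathcomp Require Import all_classical all_reals all_analysis.
From mathcomp Require Import measurable_realfun.

Set Implicit Arguments.
Unset Strict Implicit.
Unset Printing Implicit Defensive.

Import Order.TTheory GRing.Theory Num.Theory.
Import numFieldNormedType.Exports.

Local Open Scope classical_set_scope.
Local Open Scope ring_scope.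

(** * Primitivity of irreducible aperiodic matrices *)

(** The least positive difference [d] between two elements of [T] divides every element, since a
    nonzero remainder would be a smaller difference. Hence [d = 1], and two consecutive elements of
    [T] generate all large integers. *)
Lemma semigroup_cofinite (T : nat -> Prop) :
    (forall a b, T a -> T b -> T (a + b)%N) ->
    (exists2 a, (0 < a)%N & T a) ->
    (forall m, (forall k, (0 < k)%N -> T k -> (m %| k)%N) -> m = 1%N) ->
  exists N, forall k, (N <= k)%N -> T k.
Proof.
move=> TD [a0 a0_gt0 Ta0] gcd1.
have TM k a : (0 < k)%N -> T a -> T (k * a)%N.
  elim: k => // -[|k] IHk _ Ta; first by rewrite mul1n.
  by rewrite mulSn; apply: TD => //; apply: IHk.
pose P d := `[< (0 < d)%N /\ exists2 b, T b & T (b + d)%N >].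
have Pa0 : exists d, P d.
  by exists a0; apply/asboolP; split=> //; exists a0 => //; exact: TD.
have [d /asboolP[d_gt0 [b Tb Tbd]] dmin] := ex_minnP Pa0.
have d1 : d = 1%N.
  apply: gcd1 => k k_gt0 Tk; rewrite /dvdn; apply: contrapT => /negP kd0.
  have kd_gt0 : (0 < k %% d)%N by rewrite lt0n.
  have /dmin : P (k %% d)%N.
    apply/asboolP; split=> //.
    (* With [q = k %/ d], adding [k %% d] to this element gives [q * b + (b + d) + k], again a sum
       of elements of [T]. *)
    exists ((k %/ d).+1 * (b + d))%N; first exact: TM.
    have -> : ((k %/ d).+1 * (b + d) + k %% d = (k %/ d).+1 * b + (k + d))%N.
      rewrite {4}(divn_eq k d) mulnDr; nia.
    rewrite mulSn -addnA addnC -addnA [(k + d + b)%N]addnC.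
    have -> : ((k %/ d) * b + (b + (k + d)) = (k %/ d) * b + ((b + d) + k))%N by lia.
    case: (k %/ d)%N => [|q]; first by rewrite mul0n add0n; exact: TD.
    by apply: (TD); [exact: TM | exact: TD].
  by rewrite leqNgt ltn_mod d_gt0.
(* For [b > 0] and [k = q * b + s] with [s < b], write [k = (q - s) * b + s * (b + 1)]; the
   threshold ensures [s < b <= q]. *)
subst d; exists (b.+1 * b.+1)%N => k bk.
have [b0|b_gt0] := posnP b.
  have T1 : T 1%N by move: Tbd; rewrite b0.
  by rewrite -(muln1 k); apply: TM => //; apply: leq_trans bk; rewrite muln_gt0.
have kbb : (b <= k %/ b)%N by rewrite leq_divRL//; nia.
have lt := ltn_pmod k b_gt0.
have -> : k = ((k %/ b - k %% b) * b + (k %% b) * (b + 1))%N.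
  rewrite mulnBl {1}(divn_eq k b).
  have : (k %% b * b <= k %/ b * b)%N by rewrite leq_mul2r (leq_trans (ltnW lt)) ?orbT.
  nia.
have Tl : T ((k %/ b - k %% b) * b)%N by apply: TM => //; rewrite subn_gt0 (leq_trans lt).
case: (k %% b)%N Tl => [|s] Tl; first by rewrite mul0n addn0.
by apply: TD => //; exact: TM.
Qed.

Section paths.
Variables (n : nat) (A : 'M[bool]_n.+1).

Lemma paths0 i j : (0 < paths A 0 i j)%N = (i == j).
Proof. by rewrite /paths expr0 mxE; case: eqP. Qed.

Lemma pathsD k l i j m : (0 < paths A k i j)%N -> (0 < paths A l j m)%N ->
  (0 < paths A (k + l) i m)%N.
Proof.
move=> kij ljm; rewrite /paths exprD mxE lt0n sum_nat_eq0; apply/forallPn.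
by exists j => /=; rewrite muln_eq0 negb_or -!lt0n kij.
Qed.

Lemma pathsSP k i j : (0 < paths A k.+1 i j)%N ->
  exists2 l, A i l & (0 < paths A k l j)%N.
Proof.
rewrite /paths exprS mxE lt0n sum_nat_eq0 => /forallPn[l /=].
rewrite muln_eq0 negb_or mxE -lt0n => /andP[Ail klj]; exists l; last by rewrite lt0n.
by case: (A i l) Ail.
Qed.

(** All large integers are return times to a given state; returns are followed by a path of fixed
    length to the target, and finiteness of the state set makes the bound uniform. *)
Lemma paths_primitive : irreducible_mx A -> aperiodic_mx A ->
  exists p, forall q i j, (p <= q)%N -> (0 < paths A q i j)%N.
Proof.
move=> irrA aperA.
have ret i : exists N, forall k, (N <= k)%N -> (0 < paths A k i i)%N.
  apply: semigroup_cofinite; first by move=> a b; exact: pathsD.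
  - by have [k k_gt0 ki] := irrA i i; exists k.
  - exact: aperA.
have [f fP] := choice ret.
have con i : exists g : 'I_n.+1 -> nat, forall j, (0 < paths A (g j) i j)%N.
  have /choice[g gP] j : exists k, (0 < paths A k i j)%N.
    by have [k _ kij] := irrA i j; exists k.
  by exists g.
have [g gP] := choice con.
exists (\max_i f i + \max_i \max_j g i j)%N => q i j pq.
have fi : (f i <= \max_i f i)%N by apply: leq_bigmax_cond.
have gij : (g i j <= \max_i \max_j g i j)%N.
  by apply: leq_trans (leq_bigmax_cond _ _) => //; apply: leq_bigmax_cond.
have -> : q = ((q - g i j) + g i j)%N by rewrite subnK//; lia.
by apply: pathsD (gP i j); apply: fP; lia.
Qed.

End paths.

(** * Words, cylinders and the topology of the shift *)

Section points.
Context n (A : 'M[bool]_n.+1) (irrA : irreducible_mx A).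
Implicit Types (x y z : sft irrA) (N M k : nat).

Lemma sft_coordP x y : sft_coord x =1 sft_coord y -> x = y.
Proof.
move=> xy; apply: eq_sig_hprop => /=; first by move=> ? ? ?; exact: Prop_irrelevance.
exact/funext.
Qed.

Lemma sft_allowed x k : A (sft_coord x k) (sft_coord x k.+1).
Proof. by have := set_mem (svalP x); apply. Qed.

Lemma sft_of_subproof (f : nat -> 'I_n.+1) : (forall k, A (f k) (f k.+1)) ->
  (f : {ptws nat -> discrete_topology 'I_n.+1}) \in sft_set A.
Proof. by move=> fA; rewrite inE. Qed.

Definition sft_of (f : nat -> 'I_n.+1) (fA : forall k, A (f k) (f k.+1)) :
    sft irrA :=
  exist (fun u => u \in sft_set A) _ (sft_of_subproof fA).

Lemma sft_ofE f fA k : sft_coord (@sft_of f fA) k = f k.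
Proof. by []. Qed.

Lemma sft_coord_iter N x k :
  sft_coord (iter N sft_shift x) k = sft_coord x (N + k).
Proof.
elim: N k => // N IHN k.
by rewrite iterS /sft_coord/= -/(sft_coord _ _) IHN addnS addSn.
Qed.

Lemma sft_cat_subproof x N y : sft_coord x N = sft_coord y 0 -> forall k,
  A (if (k < N)%N then sft_coord x k else sft_coord y (k - N))
    (if (k.+1 < N)%N then sft_coord x k.+1 else sft_coord y (k.+1 - N)).
Proof.
move=> xy k; have [kN|Nk] := ltnP k N; last first.
  by rewrite ltnNge (leq_trans Nk)//= subSn//; exact: sft_allowed.
have [SkN|NSk] := ltnP k.+1 N; first exact: sft_allowed.
by rewrite (_ : N = k.+1) in xy *; [rewrite subnn -xy; exact: sft_allowed | lia].
Qed.

(* Junk value [y] when the words cannot be concatenated. *)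
Definition sft_cat x N y : sft irrA :=
  match pselect (sft_coord x N = sft_coord y 0) with
  | left xy => sft_of (sft_cat_subproof xy)
  | right _ => y
  end.

Lemma sft_catE x N y k : sft_coord x N = sft_coord y 0 ->
  sft_coord (sft_cat x N y) k =
  if (k < N)%N then sft_coord x k else sft_coord y (k - N).
Proof. by rewrite /sft_cat; case: pselect. Qed.

Lemma sft_cat_lt x N y k : sft_coord x N = sft_coord y 0 -> (k <= N)%N ->
  sft_coord (sft_cat x N y) k = sft_coord x k.
Proof.
move=> xy; rewrite leq_eqVlt sft_catE// => /predU1P[->|->//].
by rewrite ltnn subnn.
Qed.

Lemma iter_sft_cat x N y : sft_coord x N = sft_coord y 0 ->
  iter N sft_shift (sft_cat x N y) = y.
Proof.
move=> xy; apply: sft_coordP => k.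
by rewrite sft_coord_iter sft_catE// ltnNge leq_addr/= addKn.
Qed.

Definition cylinder x N : set (sft irrA) :=
  [set y | forall k, (k < N)%N -> sft_coord y k = sft_coord x k].

Lemma cylinder_sym x y N : cylinder x N y -> cylinder y N x.
Proof. by move=> xy k kN; rewrite xy. Qed.

Lemma cylinder_trans x y z N : cylinder x N y -> cylinder y N z -> cylinder x N z.
Proof. by move=> xy yz k kN; rewrite yz// xy. Qed.

Lemma sub_cylinder x N M : (N <= M)%N -> cylinder x M `<=` cylinder x N.
Proof. by move=> NM y xy k kN; apply: xy; exact: leq_trans NM. Qed.

Lemma cylinder_eq x y N : cylinder x N y -> cylinder x N = cylinder y N.
Proof.
move=> xy; apply/seteqP; split=> z zN; last exact: cylinder_trans zN.
exact: cylinder_trans (cylinder_sym xy) zN.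
Qed.

Lemma cylinder_iter x y N M : cylinder x (N + M) y ->
  cylinder (iter N sft_shift x) M (iter N sft_shift y).
Proof. by move=> xy k kM; rewrite !sft_coord_iter xy// ltn_add2l. Qed.

Lemma cylinder_cat x N y : sft_coord x N = sft_coord y 0 ->
  cylinder x N.+1 (sft_cat x N y).
Proof. by move=> xy k kN; rewrite sft_cat_lt. Qed.

Lemma cylinder_catD x N y M : cylinder (iter N sft_shift x) M.+1 y ->
  cylinder x (N + M.+1) (sft_cat x N y).
Proof.
move=> xy k kNM; have xy0 : sft_coord x N = sft_coord y 0.
  by rewrite xy// sft_coord_iter addn0.
rewrite sft_catE//; case: ltnP => // Nk.
by rewrite xy ?sft_coord_iter ?subnKC//; lia.
Qed.

Lemma sft_cat_iter x y N : cylinder x N y -> sft_coord x N = sft_coord y N ->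
  sft_cat x N (iter N sft_shift y) = y.
Proof.
move=> xy xyN; apply: sft_coordP => k.
rewrite sft_catE ?sft_coord_iter ?addn0//.
by case: ltnP => kN; [rewrite xy | rewrite subnKC].
Qed.

Lemma sft_connect p q x N y :
  (forall q i j, (p <= q)%N -> (0 < paths A q i j)%N) -> (p <= q)%N ->
  exists z, cylinder x N.+1 z /\ iter (N + q) sft_shift z = y.
Proof.
move=> prim pq.
have [z [z0 zy]] : exists z, sft_coord z 0 = sft_coord x N /\
    iter q sft_shift z = y.
  have := prim q (sft_coord x N) (sft_coord y 0) pq.
  move: (sft_coord x N) => i {p prim pq}.
  elim: q i => [i|q IHq i]; first by rewrite paths0 => /eqP ->; exists y.
  move=> /pathsSP[l Ail /IHq[z [z0 zy]]].
  have fA k : A (if k is k'.+1 then sft_coord z k' else i) (sft_coord z k).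
    by case: k => [|k]; [rewrite z0 | exact: sft_allowed].
  exists (sft_of (f := fun k => if k is k'.+1 then sft_coord z k' else i) fA).
  split => //; rewrite iterSr -zy; congr iter.
  by apply: sft_coordP => k; rewrite -[sft_shift _]/(iter 1 _ _) sft_coord_iter.
exists (sft_cat x N z); split; first exact: cylinder_cat.
by rewrite addnC iterD iter_sft_cat.
Qed.

Definition finite_range (P : set (sft irrA)) N :=
  forall x y, cylinder x N y -> P x -> P y.

Lemma finite_rangeW P N M : (N <= M)%N -> finite_range P N -> finite_range P M.
Proof. by move=> NM PN x y /(sub_cylinder NM); exact: PN. Qed.

Lemma finite_rangeC P N : finite_range P N -> finite_range (~` P) N.
Proof. by move=> PN x y xy Px Py; apply: Px; exact: PN (cylinder_sym xy) Py. Qed.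

Lemma finite_rangeU P Q N M : finite_range P N -> finite_range Q M ->
  finite_range (P `|` Q) (maxn N M).
Proof.
move=> PN QM x y xy [Px|Qx]; [left|right].
- exact: finite_rangeW (leq_maxl _ _) PN _ _ xy Px.
- exact: finite_rangeW (leq_maxr _ _) QM _ _ xy Qx.
Qed.

Lemma finite_range_cylinder x N : finite_range (cylinder x N) N.
Proof. by move=> y z yz xy; exact: cylinder_trans yz. Qed.

Lemma sft_coord_continuous k :
  continuous ((fun x => sft_coord x k) : sft irrA -> discrete_topology 'I_n.+1).
Proof.
move=> x; apply: (@continuous_comp (sft irrA)
  {ptws nat -> discrete_topology 'I_n.+1} (discrete_topology 'I_n.+1)
  (fun y => sval y) (fun f => f k)).
  exact: initial_continuous.
exact: (@proj_continuous _ (fun _ => discrete_topology 'I_n.+1) k (sval x)).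
Qed.

Lemma nbhs_cylinder x N : nbhs x (cylinder x N).
Proof.
elim: N => [|N IHN]; first by apply: filterS filterT => y _ k.
have /sft_coord_continuous : nbhs (sft_coord x N : discrete_topology _)
    [set sft_coord x N] by exact: discrete_set1.
move=> xN; near=> y => k; rewrite ltnS leq_eqVlt => /predU1P[->|].
  by near: y.
by move: k; near: y.
Unshelve. all: end_near. Qed.

(** Otherwise points [y N] of [cylinder x N] outside [U] would converge to [x] in every coordinate,
    hence in the product topology. *)
Lemma nbhs_sftP x (U : set (sft irrA)) :
  nbhs x U <-> exists N, cylinder x N `<=` U.
Proof.
split=> [|[N NU]]; last exact: filterS (nbhs_cylinder x N).
move=> nU; apply: contrapT => /forallNP noN.
have /choice[y yP] N : exists y, cylinder x N y /\ ~ U y.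
  have /existsNP[y /not_implyP[xy Uy]] := noN N; by exists y.
suff yx : y @ \oo --> x.
  by have [N _ /(_ N (leqnn N))/=] := yx _ nU; have [] := yP N.
have yx : (fun N => sval (y N) : {ptws nat -> discrete_topology 'I_n.+1}) @ \oo
    --> (sval x : {ptws nat -> discrete_topology 'I_n.+1}).
  apply/cvg_sup => k V [W [[Z oZ <-] Wx WV]].
  apply: filterS WV _; exists k.+1 => // N /= kN.
  have [/(_ k kN)] := yP N; rewrite /sft_coord => -> _; exact: Wx.
move=> V; rewrite nbhsE => -[W [[Z oZ <-] Zx] WV].
have [N _ NZ] := yx Z (open_nbhs_nbhs (conj oZ Zx)).
by exists N => // M /NZ ZyM; exact: WV.
Qed.

Lemma open_sftP (U : set (sft irrA)) :
  open U <-> forall x, U x -> exists N, cylinder x N `<=` U.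
Proof.
rewrite openE; split=> [oU x /oU /nbhs_sftP//|oU x Ux].
by apply/nbhs_sftP; exact: oU.
Qed.

Lemma finite_range_open P N : finite_range P N -> open P.
Proof. by move=> PN; apply/open_sftP => x Px; exists N => y /PN; exact. Qed.

Lemma open_measurable_sft (U : set (sft irrA)) : open U -> measurable U.
Proof. by move=> oU; exact: sub_sigma_algebra. Qed.

Lemma finite_range_measurable P N : finite_range P N -> measurable P.
Proof. by move=> /finite_range_open; exact: open_measurable_sft. Qed.

Lemma cylinder_measurable x N : measurable (cylinder x N).
Proof. exact: finite_range_measurable (@finite_range_cylinder _ _). Qed.

(** The hypothesis is a coordinatewise form of continuity, so preimages of the open sets, which
    generate the Borel structure, are open. *)
Lemma finite_range_fun_measurable (f : sft irrA -> sft irrA) :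
  (forall k, exists N, forall x y, cylinder x N y ->
    sft_coord (f y) k = sft_coord (f x) k) -> measurable_fun setT f.
Proof.
move=> fP.
have fN M : exists N, forall x y, cylinder x N y -> cylinder (f x) M (f y).
  elim: M => [|M [N IHN]]; first by exists 0%N.
  have [N' N'P] := fP M; exists (maxn N N') => x y xy k.
  rewrite ltnS leq_eqVlt => /predU1P[->|].
    by apply: N'P; apply: sub_cylinder xy; exact: leq_maxr.
  by apply: IHN; apply: sub_cylinder xy; exact: leq_maxl.
apply: (@measurability _ _ (sft irrA) (sft irrA) setT f (@open (sft irrA)) erefl).
move=> _ [U oU <-]; rewrite setTI; apply: open_measurable_sft.
apply/open_sftP => x Ux; have /open_sftP/(_ _ Ux)[M MU] := oU.
by have [N NP] := fN M; exists N => y /NP; exact: MU.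
Qed.

(* Koenig's lemma: a word on whose cylinder no [r] works has a one-letter extension
   with the same defect. *)
Lemma continuous_finite_range (T : choiceType) (f : sft irrA -> T) :
  continuous (f : sft irrA -> discrete_topology T) ->
  exists r, forall x y, cylinder x r y -> f y = f x.
Proof.
move=> fc; apply: contrapT => nr.
pose bad x N := ~ exists r, forall y z, cylinder x N y -> cylinder y r z -> f z = f y.
have bad_next x N : bad x N -> exists y, cylinder x N y /\ bad y N.+1.
  move=> badx; apply: contrapT => /forallNP gd; apply: badx.
  have /choice[r rP] i : exists r, forall y z, cylinder x N y ->
      sft_coord y N = i -> cylinder y r z -> f z = f y.
    have [[y [xy yi]]|ny] := pselect (exists y, cylinder x N y /\ sft_coord y N = i).
      have [r rP] : exists r, forall u z, cylinder y N.+1 u -> cylinder u r z ->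
          f z = f u by apply: contrapT => nrr; exact: (gd y).
      exists r => u z xu ui; apply: rP => k; rewrite ltnS leq_eqVlt.
      by move=> /predU1P[->|kN]; rewrite ?yi// xu// xy.
    by exists 0%N => y z xy yi; exfalso; apply: ny; exists y.
  exists (\max_i r i) => y z xy yz; apply: (rP (sft_coord y N)) => //.
  apply: sub_cylinder yz; exact: leq_bigmax_cond.
have [x0 _] : exists x : sft irrA, True by exists point.
have bad0 : bad x0 0%N.
  by move=> [r rP]; apply: nr; exists r => x y; apply: rP.
have /choice[g gP] (p : sft irrA * nat) : exists y, bad p.1 p.2 ->
    cylinder p.1 p.2 y /\ bad y p.2.+1.
  have [/bad_next[y yP]|nb] := pselect (bad p.1 p.2); first by exists y.
  by exists x0.
pose s := fix s N := if N is M.+1 then g (s M, M) else x0.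
have sbad N : bad (s N) N.
  by elim: N => //= N IHN; have [] := gP (s N, N) IHN.
have sS N : cylinder (s N) N (s N.+1) by have [] := gP (s N, N) (sbad N).
have sle N M : (N <= M)%N -> cylinder (s N) N (s M).
  elim: M => [|M IHM]; first by rewrite leqn0 => /eqP ->.
  rewrite leq_eqVlt => /predU1P[->//|NM].
  by apply: cylinder_trans (IHM NM) _; exact: sub_cylinder (sS M).
have fA k : A (sft_coord (s k.+1) k) (sft_coord (s k.+2) k.+1).
  rewrite -(sle k.+1 k.+2 _ k)//; exact: sft_allowed.
(* The nested bad words have a common point [x]; continuity of [f] at [x] makes [f] constant on one
   of their cylinders. *)
pose x := sft_of fA.
have xs N : cylinder (s N) N x.
  by move=> k kN; rewrite sft_ofE -(sle k.+1 N kN k).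
have /nbhs_sftP[N NP] : nbhs x [set y | f y = f x].
  by apply: (fc x [set f x]); exact: discrete_set1.
apply: (sbad N); exists N => y z sy yz.
have xy := cylinder_trans (cylinder_sym (xs N)) sy.
by rewrite (NP _ xy) (NP _ (cylinder_trans xy yz)).
Qed.

End points.

(** * Approximation of measurable sets by cylinders *)

Section probability_estimates.
Context d (T : measurableType d) (R : realType) (mu : probability T R).

Lemma nonincreasing_measure_small (F : (set T)^nat) (e : R) :
    (forall k, measurable (F k)) -> (forall k, F k.+1 `<=` F k) ->
    \bigcap_k F k = set0 -> 0 < e -> exists N, (mu (F N) < e%:E)%E.
Proof.
move=> mF decF F0 e0.
have : mu \o F @ \oo --> mu (\bigcap_k F k).
  apply: nonincreasing_cvg_mu => //; first by rewrite ltey_eq fin_num_measure.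
    by apply: bigcapT_measurable.
  by apply/nonincreasing_seqP => k; apply/subsetPset.
rewrite F0 measure0 => /fine_cvgP[_ /cvgrPdist_lt/(_ e e0)[N _ NP]].
exists N; have := NP N (leqnn N); rewrite /= sub0r normrN ger0_norm ?fine_ge0//.
by rewrite -lte_fin fineK// fin_num_measure.
Qed.

Lemma le_mu (P Q : set T) : measurable P -> measurable Q -> P `<=` Q ->
  (mu P <= mu Q)%E.
Proof. by move=> mP mQ PQ; apply: le_measure => //; rewrite inE. Qed.

Lemma mu_gt0P (P : set T) : measurable P -> mu P <> 0%E -> (0 < mu P)%E.
Proof. by move=> mP P0; rewrite lt0e measure_ge0 andbT; apply/eqP. Qed.

Lemma mu_eq0_small (P : set T) : measurable P ->
  (forall e : R, 0 < e -> (mu P <= e%:E)%E) -> mu P = 0%E.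
Proof.
move=> mP Pe; apply/eqP; rewrite eq_le measure_ge0 andbT.
by apply/lee_addgt0Pr => e e0; rewrite add0e; exact: Pe.
Qed.

(* The fibres of [g] and [h] cut [P] and [Q] into countably many pieces. *)
Lemma le_mu_fibers (I : countType) (P Q : set T) (g h : T -> I) (K : R) :
    0 <= K -> measurable P -> measurable Q ->
    (forall i, measurable (g @^-1` [set i])) ->
    (forall i, measurable (h @^-1` [set i])) ->
    (forall i, (mu (P `&` g @^-1` [set i]) <=
                K%:E * mu (Q `&` h @^-1` [set i]))%E) ->
  (mu P <= K%:E * mu Q)%E.
Proof.
move=> K0 mP mQ mg mh PQ.
(* [f u S k] is the piece of [S] on which [u] has code [k]; the test [pickle i == k] gives each
   value a single index, so that the pieces are disjoint. *)
pose f (u : T -> I) (S : set T) (k : nat) :=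
  if unpickle k is Some i then
    (if pickle i == k then S `&` u @^-1` [set i] else set0) else set0.
have fE u S : S = \bigcup_k f u S k.
  apply/seteqP; split=> [x Sx|x [k _]].
    by exists (pickle (u x)) => //; rewrite /f pickleK eqxx.
  by rewrite /f; case: unpickle => // i; case: eqP => // _ [].
have mf u S k : (forall i, measurable (u @^-1` [set i])) -> measurable S ->
    measurable (f u S k).
  by move=> mu' mS; rewrite /f; case: unpickle => // i; case: eqP => // _; apply: measurableI.
have tf u S : trivIset setT (f u S).
  apply/trivIsetP => k l _ _ kl; rewrite /f.
  case: (unpickle k) => [i|]; last by rewrite set0I.
  case: eqP => [ki|_]; last by rewrite set0I.
  case: (unpickle l) => [j|]; last by rewrite setI0.
  case: eqP => [jl|_]; last by rewrite setI0.
  apply/seteqP; split=> // x [[_ /= xi] [_ xj]].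
  by move: kl; rewrite -ki -jl -xi -xj eqxx.
have fle k : (mu (f g P k) <= K%:E * mu (f h Q k))%E.
  rewrite /f; case: unpickle => [i|]; last by rewrite !measure0 mule0.
  by case: eqP => _ //; rewrite !measure0 mule0.
rewrite (fE g P) (fE h Q) !measure_bigcup//=; try by [exact: tf|move=> *; exact: mf].
rewrite -nneseriesZl//.
by apply: lee_nneseries => // k _; rewrite mule_ge0 ?lee_fin.
Qed.

End probability_estimates.

Section approximation.
Context n (A : 'M[bool]_n.+1) (irrA : irreducible_mx A) (R : realType).
Variable mu : probability (sft irrA) R.

(** The approximable sets contain the open sets, which are increasing unions of finite-range sets,
    and are closed under complements, finite unions and increasing unions; hence they form a
    sigma-algebra. *)
Lemma finite_range_approx (B : set (sft irrA)) (e : R) : measurable B -> 0 < e ->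
  exists N D, finite_range D N /\ (mu (B `\` D `|` D `\` B) <= e%:E)%E.
Proof.
move: B e; pose appr (B : set (sft irrA)) := measurable B /\ forall e : R, 0 < e ->
  exists N D, finite_range D N /\ (mu (B `\` D `|` D `\` B) <= e%:E)%E.
suff ap : measurable `<=` appr by move=> B e /ap[_]; apply.
have mfr (D : set (sft irrA)) N : finite_range D N -> measurable D.
  exact: finite_range_measurable.
have apprU (F : (set (sft irrA))^nat) : (forall k, appr (F k)) ->
    (forall k, F k `<=` F k.+1) -> appr (\bigcup_k F k).
  move=> aF incF.
  have mF : measurable (\bigcup_k F k) by apply: bigcupT_measurable => k; apply: (aF k).1.
  split=> // e e0.
  have [||||N NP] := @nonincreasing_measure_small _ _ _ mu
      (fun k => \bigcup_k F k `\` F k) (e / 2).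
  - by move=> k; apply: measurableD => //; apply: (aF k).1.
  - by move=> k x [Fx nF]; split=> // /incF.
  - apply/seteqP; split=> // x xF; have [[k _ Fk] _] := xF 0%N I.
    by have [_] := xF k I.
  - by rewrite divr_gt0.
  have [M [D [DM De]]] := (aF N).2 (e / 2) ltac:(by rewrite divr_gt0).
  exists M, D; split=> //.
  have mFN := (aF N).1.
  have mD := mfr _ _ DM.
  apply: (@le_trans _ _ (mu ((\bigcup_k F k `\` F N) `|` (F N `\` D `|` D `\` F N)))).
    apply: le_mu; do ?[apply: measurableU | apply: measurableD] => //.
    move=> x [[Fx nD]|[Dx nF]].
      by have [FN|FN] := pselect (F N x); [right; left|left].
    by right; right; split=> // FN; apply: nF; exists N.
  apply: le_trans (measureU2 _ _ _) _; do ?[apply: measurableU | apply: measurableD] => //.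
  by rewrite [e]splitr EFinD leeD// ltW.
apply: smallest_sub; last first.
  move=> U oU; pose F k := [set x | cylinder x k `<=` U].
  have FU : U = \bigcup_k F k.
    apply/seteqP; split=> x; last by move=> [k _]; apply.
    by move/open_sftP : oU => /[apply] -[N NU]; exists N.
  have Ffr k : finite_range (F k) k.
    by move=> x y xy; rewrite /F/= (cylinder_eq xy).
  rewrite FU; apply: apprU => k; last first.
    by move=> x /= xU; apply: subset_trans xU; apply: sub_cylinder.
  split; first exact: mfr (Ffr k).
  by move=> e e0; exists k, (F k); rewrite !setDv setU0 measure0 lee_fin ltW.
have apprC B' : appr B' -> appr (~` B').
  move=> [mB aB]; split; first exact: measurableC.
  move=> e /aB[N [D [DN De]]]; exists N, (~` D); split; first exact: finite_rangeC.
  by rewrite !setDE !setCK setUC [~` D `&` _]setIC [~` B' `&` _]setIC.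
have apprU2 B1 B2 : appr B1 -> appr B2 -> appr (B1 `|` B2).
  move=> [mB1 aB1] [mB2 aB2]; split; first exact: measurableU.
  move=> e e0; have e2 : 0 < e / 2 by rewrite divr_gt0.
  have [N1 [D1 [DN1 De1]]] := aB1 _ e2; have [N2 [D2 [DN2 De2]]] := aB2 _ e2.
  exists (maxn N1 N2), (D1 `|` D2); split; first exact: finite_rangeU.
  have mD1 := mfr _ _ DN1; have mD2 := mfr _ _ DN2.
  apply: (@le_trans _ _
      (mu ((B1 `\` D1 `|` D1 `\` B1) `|` (B2 `\` D2 `|` D2 `\` B2)))).
    apply: le_mu; do ?[apply: measurableU | apply: measurableD] => //;
      do ?[apply: measurableU | apply: measurableD] => //.
    by move=> x [[[?|?] /not_orP[? ?]]|[[?|?] /not_orP[? ?]]];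
      [left; left|right; left|left; right|right; right].
  apply: le_trans (measureU2 _ _ _) _; do ?[apply: measurableU | apply: measurableD] => //.
  by rewrite [e]splitr EFinD leeD.
have appr0 : appr set0.
  split => // e e0; exists 0%N, set0; split=> //.
  by rewrite !setDv setU0 measure0 lee_fin ltW.
split=> //; first by move=> B' /apprC; rewrite setTD.
move=> F aF; rewrite (_ : \bigcup_k F k = \bigcup_k \big[setU/set0]_(i < k.+1) F i).
  apply: apprU => k.
    by elim: k => [|k IHk]; rewrite big_ord_recr/= ?big_ord0 ?set0U//; apply: apprU2.
  by rewrite [in X in _ `<=` X]big_ord_recr/=; left.
by rewrite -bigcup_bigsetU_bigcup.
Qed.

End approximation.

(** * Tail equivalence and Birkhoff sums *)

Section tail_relations.
Context n (A : 'M[bool]_n.+1) (irrA : irreducible_mx A).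
Implicit Types x y : sft irrA.

Lemma gibbs_relationP x y : gibbs_relation irrA (x, y) <->
  exists N, iter N sft_shift x = iter N sft_shift y.
Proof.
split=> -[N xy]; exists N.
  by apply: sft_coordP => k; rewrite !sft_coord_iter xy//= leq_addr.
by move=> k Nk /=; rewrite -(subnKC Nk) -!sft_coord_iter xy.
Qed.

Lemma sft_cat_measurable (a : sft irrA) N :
  measurable_fun setT (fun x => sft_cat a N (iter N sft_shift x)).
Proof.
apply: finite_range_fun_measurable => k; exists (N + k).+1 => x y xy.
have xyN : sft_coord y N = sft_coord x N by apply: xy; rewrite ltnS leq_addr.
have [aN|aN] := eqVneq (sft_coord a N) (sft_coord x N).
  rewrite !sft_catE ?sft_coord_iter ?addn0 ?xyN//.
  by case: ltnP => // Nk; rewrite xy//; lia.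
rewrite /sft_cat; case: pselect => [e|_]; case: pselect => [e'|_].
- by move: aN; rewrite e' sft_coord_iter addn0 eqxx.
- by move: aN; rewrite e sft_coord_iter addn0 xyN eqxx.
- by move: aN; rewrite e' sft_coord_iter addn0 eqxx.
- by rewrite !sft_coord_iter xy//.
Qed.

(** The saturation is a countable union over [N] and over the finitely many words that can replace
    the first [N] letters. For each choice, membership combines finite-range conditions with the
    preimage of [B] under a measurable map. *)
Lemma tail_saturation_measurable (P : nat -> sft irrA -> sft irrA -> Prop) B :
    (forall N, exists M, forall x x' y y',
      cylinder x M x' -> cylinder y M y' -> P N x y -> P N x' y') ->
    measurable B ->
  measurable (saturation
    [set p | exists N, iter N sft_shift p.1 = iter N sft_shift p.2 /\ P N p.1 p.2] B).
Proof.
move=> PM mB.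
(* For an inadmissible word [w] the choice is [point], which still produces only points of the
   saturation. *)
pose a N (w : {ffun 'I_N.+1 -> 'I_n.+1}) : sft irrA :=
  xget point [set a | forall k : 'I_N.+1, sft_coord a k = w k].
pose f N w x := sft_cat (a N w) N (iter N sft_shift x).
have mf N w : measurable_fun setT (f N w) by exact: sft_cat_measurable.
have -> : saturation
    [set p | exists N, iter N sft_shift p.1 = iter N sft_shift p.2 /\ P N p.1 p.2] B =
    \bigcup_N \bigcup_w ([set x | sft_coord (a N w) N = sft_coord x N] `&`
      ([set x | P N (f N w x) x] `&` f N w @^-1` B)).
  apply/seteqP; split=> x'.
    move=> [x Bx [N /= [xx' PN]]].
    pose w := [ffun k : 'I_N.+1 => sft_coord x k].
    have aw : cylinder (a N w) N.+1 x.
      have : [set b | forall k : 'I_N.+1, sft_coord b k = w k] (a N w).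
        apply: (@xgetI _ _ [set b | forall k : 'I_N.+1, sft_coord b k = w k] x).
        by move=> k; rewrite ffunE.
      move=> awk k kN; have := awk (Ordinal kN).
      by rewrite ffunE /= => ->.
    have fx : f N w x' = x.
      rewrite /f -xx' sft_cat_iter//; first exact: sub_cylinder aw.
      by rewrite aw.
    exists N => //; exists w => //; split; last by rewrite /= fx.
    rewrite /= -(aw N)// -[in LHS](addn0 N) -[in RHS](addn0 N) -!sft_coord_iter.
    by rewrite xx'.
  move=> [N _ [w _ [/= aN [Pf Bf]]]]; exists (f N w x') => //; exists N => /=.
  by split=> //; rewrite /f iter_sft_cat// sft_coord_iter addn0.
apply: bigcupT_measurable => N; apply: countable_bigcupT_measurable => // w.
apply: measurableI.
  apply: (@finite_range_measurable _ _ _ _ N.+1) => x y xy /= ->.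
  by rewrite xy.
apply: measurableI; last by rewrite -[X in measurable X]setTI; exact: mf.
have [M MP] := PM N.
apply: (@finite_range_measurable _ _ _ _ (maxn N.+1 (N + M))) => x y xy /=.
apply: MP; last by apply: sub_cylinder xy; lia.
move=> k kM; have xyN : sft_coord y N = sft_coord x N by apply: xy; lia.
have [aN|aN] := eqVneq (sft_coord (a N w) N) (sft_coord x N).
  rewrite !sft_catE ?sft_coord_iter ?addn0 ?xyN//.
  by case: ltnP => // Nk; rewrite xy//; lia.
rewrite /f /sft_cat; case: pselect => [e|_]; case: pselect => [e'|_].
- by move: aN; rewrite e' sft_coord_iter addn0 eqxx.
- by move: aN; rewrite e sft_coord_iter addn0 xyN eqxx.
- by move: aN; rewrite e' sft_coord_iter addn0 eqxx.
- by rewrite !sft_coord_iter xy//; lia.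
Qed.

Lemma gibbs_saturation_measurable B :
  measurable B -> measurable (saturation (gibbs_relation irrA) B).
Proof.
move=> mB; have := @tail_saturation_measurable (fun _ _ _ => True) B _ mB.
rewrite (_ : [set p | _] = gibbs_relation irrA); first by apply=> N; exists 0%N.
apply/seteqP; split=> -[x y]; rewrite gibbs_relationP/=.
  by move=> [N []]; exists N.
by move=> [N]; exists N.
Qed.

End tail_relations.

(** * Birkhoff sums of a function of summable variation *)

Section birkhoff.
Context n (A : 'M[bool]_n.+1) (irrA : irreducible_mx A) (R : realType).
Variable phi : sft irrA -> R.
Hypothesis phi_sv : summable_variation phi.

Definition birkhoff N x := \sum_(0 <= k < N) phi (iter k sft_shift x).

Lemma birkhoffD N M x :
  birkhoff (N + M) x = birkhoff N x + birkhoff M (iter N sft_shift x).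
Proof.
rewrite /birkhoff (@big_cat_nat _ _ _ N)//= ?leq_addr//; congr (_ + _).
have -> (F : nat -> R) :
    \sum_(N <= k < N + M) F k = \sum_(0 <= k < M) F (k + N)%N.
  by rewrite -{1}[N]add0n big_addn addKn.
by apply: eq_bigr => k _; rewrite iterD.
Qed.

Lemma omega_ge0 k : (0 <= omega phi k)%E.
Proof.
by apply: ereal_sup_ubound; exists (point, point) => //=; rewrite subrr normr0.
Qed.

Lemma omega_le k x y : cylinder x k y -> (`|phi x - phi y|%:E <= omega phi k)%E.
Proof.
by move=> xy; apply: ereal_sup_ubound; exists (x, y) => //= l lk; rewrite xy.
Qed.

(** After [j < N] shifts the two points still agree in [N - j] coordinates, so the difference is at
    most the sum of [omega phi k] over [1 <= k <= N]; [V] is the sum of the whole series. *)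
Lemma birkhoff_variation : exists2 V : R, 0 <= V &
  forall N x y, cylinder x N y -> birkhoff N x - birkhoff N y <= V.
Proof.
have [_ sv] := phi_sv; pose s := (\sum_(0 <= k <oo) omega phi k)%E.
have s0 : (0 <= s)%E by apply: nneseries_ge0 => k _ _; exact: omega_ge0.
have sfin : s \is a fin_num by rewrite ge0_fin_numE.
exists (fine s); first exact: fine_ge0.
move=> N x y xy; rewrite -lee_fin fineK//.
apply: (@le_trans _ _ (\sum_(0 <= k < N.+1) omega phi k)%E); last first.
  by apply: nneseries_lim_ge => k _ _; exact: omega_ge0.
rewrite /birkhoff -sumrB -sumEFin big_nat_recl//= -[leLHS]add0e leeD ?omega_ge0//.
rewrite big_nat_rev/= !big_mkord; apply: lee_sum => k _.
apply: (@le_trans _ _ (omega phi k.+1)); rewrite ?lexx//.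
rewrite add0n; have xyk : cylinder (iter (N - k.+1) sft_shift x) k.+1
    (iter (N - k.+1) sft_shift y).
  by apply: cylinder_iter; rewrite subnK.
by apply: le_trans (omega_le xyk); rewrite lee_fin ler_norm.
Qed.

(** No agreement of the points is assumed; this bound serves for words whose length stays fixed or
    bounded. *)
Lemma birkhoff_oscillation : exists2 M : R, 0 <= M &
  forall N x y, birkhoff N x - birkhoff N y <= N%:R * M.
Proof.
have [_ sv] := phi_sv.
have om0 : (omega phi 0 < +oo)%E.
  apply: le_lt_trans sv.
  have := @nneseries_lim_ge R (omega phi) predT 0 1 (fun k _ _ => omega_ge0 k).
  by rewrite big_nat1.
have omfin : omega phi 0 \is a fin_num by rewrite ge0_fin_numE// omega_ge0.
exists (fine (omega phi 0)); first by rewrite fine_ge0// omega_ge0.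
move=> N x y; rewrite /birkhoff -sumrB big_mkord.
apply: (@le_trans _ _ (\sum_(i < N) fine (omega phi 0))).
  apply: ler_sum => k _; rewrite -lee_fin fineK//.
  have xyk : cylinder (iter k sft_shift x) 0 (iter k sft_shift y) by [].
  by apply: le_trans (omega_le xyk); rewrite lee_fin ler_norm.
by rewrite sumr_const card_ord mulr_natl.
Qed.

End birkhoff.

(** * Distortion of Gibbs measures *)

Section distortion.
Context n (A : 'M[bool]_n.+1) (irrA : irreducible_mx A) (R : realType).
Variables (phi : sft irrA -> R) (mu : probability (sft irrA) R).
Hypothesis mu_phi : gibbs_measure phi mu.

Lemma gibbs_distribution_dominates (W : {mfun sft irrA >-> sft irrA}) :
  (forall x, gibbs_relation irrA (W x, x)) -> distribution mu W `<< mu.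
Proof.
move=> WR; apply/null_content_dominatesP => B mB B0.
have [qi _] := mu_phi; have := qi _ mB B0 => sB0.
apply/eqP; rewrite eq_le measure_ge0 andbT -sB0.
rewrite [distribution _ _ _]/(mu (W @^-1` B)).
apply: le_mu; last by move=> x Bx; exists (W x).
  by rewrite -[X in measurable X]setTI; exact: measurable_funP.
exact: gibbs_saturation_measurable.
Qed.

(** The density of the image measure is [rho (W x, x)]. On [Q] the orbits of [x] and [W x] merge at
    time [N], so its logarithm is the difference of the Birkhoff sums of length [N]. *)
Lemma gibbs_preimage_le (W : {mfun sft irrA >-> sft irrA}) N (Q : set (sft irrA))
    (c : R) : involutive W ->
    (forall x, Q x -> iter N sft_shift (W x) = iter N sft_shift x) ->
    (forall x, gibbs_relation irrA (x, W x)) ->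
    measurable Q ->
    (forall x, Q x -> birkhoff phi N (W x) - birkhoff phi N x <= c) ->
  (mu (W @^-1` Q) <= (expR c)%:E * mu Q)%E.
Proof.
move=> WW WN WR mQ Qc.
have WR' x : gibbs_relation irrA (W x, x).
  by have := WR (W x); rewrite WW.
have dom := gibbs_distribution_dominates WR'.
pose nu := charge_of_finite_measure (distribution mu W).
have [_ [rho [_ rho_gt0 rhoM rho_RN] rho_phi]] := mu_phi.
pose RN : sft irrA -> \bar R := Radon_Nikodym nu mu.
have mRN : measurable_fun setT RN.
  by apply: measurable_int; exact: Radon_Nikodym_integrable.
(* The density is clamped to the interval from [0] to [expR c]; it is unchanged almost everywhere on
   [Q], and the bounds now hold everywhere. *)
pose g (x : sft irrA) : \bar R := (maxe 0 (mine (RN x) (expR c)%:E))%E.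
have mg : measurable_fun setT g.
  by apply: measurable_maxe => //; apply: measurable_mine.
have RNg : ae_eq mu Q RN g.
  have aeW := rho_RN W W WW WW WR.
  near=> x => Qx.
  have -> : g x = RN x; last by [].
  have RNx : RN x = (rho (W x, x))%:E.
    by have : [set: sft irrA] x by []; near: x.
  have rxx : rho (x, x) = 1.
    have Rxx : gibbs_relation irrA (x, x) by exists 0%N.
    have := rhoM x x x Rxx Rxx; have := rho_gt0 _ Rxx.
    move=> rpos /(congr1 (fun u => u / rho (x, x))).
    by rewrite mulfK ?divff ?gt_eqF.
  have rV : rho (W x, x) = (rho (x, W x))^-1.
    have := rhoM x (W x) x (WR x) (WR' x); rewrite rxx => /(congr1 (fun u => (rho (x, W x))^-1 * u)).
    by rewrite mulKf ?mulr1// gt_eqF// rho_gt0.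
  have lnr : ln (rho (x, W x)) = birkhoff phi N x - birkhoff phi N (W x).
    have -> : ln (rho (x, W x)) = limn (series (fun k =>
        phi (iter k sft_shift x) - phi (iter k sft_shift (W x)))).
      by have := WR x; move: (W x); near: x.
    (* The terms of the series vanish from index [N] on. *)
    apply: (@lim_near_cst R (@Rhausdorff R)); exists N => // K /= NK.
    rewrite /birkhoff -sumrB /series/= (@big_cat_nat _ _ _ N)//= [X in _ + X]big_nat_cond.
    rewrite [X in _ + X]big1 ?addr0// => k /andP[/andP[Nk _] _].
    by rewrite -(subnK Nk) !iterD WN// subrr.
  have rle : rho (W x, x) <= expR c.
    rewrite rV -[X in X^-1]lnK ?posrE ?rho_gt0// -expRN ler_expR lnr opprB.
    exact: Qc.
  rewrite /g RNx min_l ?lee_fin// max_r// lee_fin ltW//.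
  exact: rho_gt0.
have -> : mu (W @^-1` Q) = (\int[mu]_(x in Q) RN x)%E.
  exact: (@Radon_Nikodym_integral _ _ _ nu mu Q dom mQ).
rewrite (ae_eq_integral g)//; try exact: measurable_funTS.
apply: (@le_trans _ _ (\int[mu]_(x in Q) (cst (expR c)%:E x))%E).
  apply: ge0_le_integral => //; try exact: measurable_funTS.
  - by move=> x _; rewrite le_max lexx.
  - by move=> x _; rewrite /g ge_max lee_fin expR_ge0 ge_min lexx orbT.
by rewrite integral_cst.
Unshelve. all: end_near. Qed.

End distortion.

(** * The involution exchanging two initial words *)

Section swap.
Context n (A : 'M[bool]_n.+1) (irrA : irreducible_mx A).
Variables (a b : sft irrA) (N : nat).
Hypothesis abN : sft_coord a N = sft_coord b N.

(** The tests read [N.+1] letters although only [N] are replaced: the common letter at position [N]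
    is the one at which either word is glued to the unchanged tail. *)
Definition swap_word (x : sft irrA) : sft irrA :=
  if `[< cylinder a N.+1 x >] then sft_cat b N (iter N sft_shift x)
  else if `[< cylinder b N.+1 x >] then sft_cat a N (iter N sft_shift x) else x.

Lemma swap_word_l x : cylinder a N.+1 x ->
  swap_word x = sft_cat b N (iter N sft_shift x).
Proof. by rewrite /swap_word; case: asboolP. Qed.

Lemma swap_word_r x : cylinder b N.+1 x ->
  swap_word x = sft_cat a N (iter N sft_shift x).
Proof.
rewrite /swap_word; case: asboolP => [ax bx|_]; last by case: asboolP.
have ab : cylinder a N.+1 b := cylinder_trans ax (cylinder_sym bx).
apply: sft_coordP => k; rewrite !sft_catE; last 2 first.
- by rewrite sft_coord_iter addn0 ax.
- by rewrite sft_coord_iter addn0 bx.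
by case: ltnP => // kN; rewrite ab// ltnS ltnW.
Qed.

Lemma swap_word_out x : ~ cylinder a N.+1 x -> ~ cylinder b N.+1 x -> swap_word x = x.
Proof. by move=> ax bx; rewrite /swap_word !asboolF. Qed.

Lemma cylinder_swap_l x : cylinder a N.+1 x -> cylinder b N.+1 (swap_word x).
Proof.
move=> ax; rewrite swap_word_l//; apply: cylinder_cat.
by rewrite sft_coord_iter addn0 ax.
Qed.

Lemma cylinder_swap_r x : cylinder b N.+1 x -> cylinder a N.+1 (swap_word x).
Proof.
move=> bx; rewrite swap_word_r//; apply: cylinder_cat.
by rewrite sft_coord_iter addn0 bx.
Qed.

Lemma iter_swap_word x : iter N sft_shift (swap_word x) = iter N sft_shift x.
Proof.
have [ax|ax] := pselect (cylinder a N.+1 x).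
  by rewrite swap_word_l// iter_sft_cat// sft_coord_iter addn0 ax.
have [bx|bx] := pselect (cylinder b N.+1 x); last by rewrite swap_word_out.
by rewrite swap_word_r// iter_sft_cat// sft_coord_iter addn0 bx.
Qed.

Lemma swap_wordK : involutive swap_word.
Proof.
move=> x; have [ax|ax] := pselect (cylinder a N.+1 x).
  rewrite [LHS]swap_word_r ?iter_swap_word; last exact: cylinder_swap_l.
  by rewrite sft_cat_iter//; [exact: sub_cylinder ax|rewrite ax].
have [bx|bx] := pselect (cylinder b N.+1 x); last by rewrite !swap_word_out.
rewrite [LHS]swap_word_l ?iter_swap_word; last exact: cylinder_swap_r.
by rewrite sft_cat_iter//; [exact: sub_cylinder bx|rewrite bx].
Qed.

Lemma swap_word_gibbs x : gibbs_relation irrA (x, swap_word x).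
Proof. by apply/gibbs_relationP; exists N; rewrite iter_swap_word. Qed.

Lemma swap_word_measurable : measurable_fun setT swap_word.
Proof.
apply: finite_range_fun_measurable => k; exists (N + k).+1 => x y xy.
have xyN : cylinder x N.+1 y by apply: sub_cylinder xy; lia.
have kN : sft_coord y k = sft_coord x k by apply: xy; lia.
have yN : sft_coord y N = sft_coord x N by exact: xyN.
rewrite /swap_word.
have -> : `[< cylinder a N.+1 y >] = `[< cylinder a N.+1 x >].
  apply/asbool_equiv_eq; split=> h; apply: cylinder_trans h _ => //.
  exact: cylinder_sym.
have -> : `[< cylinder b N.+1 y >] = `[< cylinder b N.+1 x >].
  apply/asbool_equiv_eq; split=> h; apply: cylinder_trans h _ => //.
  exact: cylinder_sym.
have cat c : sft_coord c N = sft_coord x N ->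
    sft_coord (sft_cat c N (iter N sft_shift y)) k =
    sft_coord (sft_cat c N (iter N sft_shift x)) k.
  move=> cx; rewrite !sft_catE ?sft_coord_iter ?addn0 ?yN//.
  by case: ltnP => // Nk; rewrite ?sft_coord_iter xy//; lia.
case: asboolP => [ax|_]; first by apply: cat; rewrite -abN ax.
by case: asboolP => [bx|//]; apply: cat; rewrite abN bx.
Qed.

End swap.

Lemma swap_wordC n (A : 'M[bool]_n.+1) (irrA : irreducible_mx A) (a b : sft irrA) N :
  sft_coord a N = sft_coord b N -> swap_word a b N =1 swap_word b a N.
Proof.
move=> ab x; have [bx|bx] := pselect (cylinder b N.+1 x).
  by rewrite swap_word_r// swap_word_l.
have [ax|ax] := pselect (cylinder a N.+1 x); last by rewrite !swap_word_out.
by rewrite swap_word_l// swap_word_r.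
Qed.

(** * Bounded distortion, density and recurrence for cylinders *)

Section cylinder_estimates.
Context n (A : 'M[bool]_n.+1) (irrA : irreducible_mx A) (R : realType).
Variables (phi : sft irrA -> R) (mu : probability (sft irrA) R).
Hypotheses (phi_sv : summable_variation phi) (mu_phi : gibbs_measure phi mu).
Implicit Types (x y z a b w : sft irrA) (Q Y : set (sft irrA)).

Lemma swap_measure_le a b N c Q : sft_coord a N = sft_coord b N ->
    measurable Q ->
    (forall x, Q x -> birkhoff phi N x - birkhoff phi N (swap_word a b N x) <= c) ->
  (mu Q <= (expR c)%:E * mu (swap_word a b N @^-1` Q))%E.
Proof.
move=> abN mQ Qc.
pose W : {mfun sft irrA >-> sft irrA} :=
  HB.pack (swap_word a b N) (isMeasurableFun.Build _ _ (sft irrA) (sft irrA)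
    (swap_word a b N) (swap_word_measurable abN)).
have WW : involutive W by exact: swap_wordK.
rewrite {1}(_ : Q = W @^-1` (W @^-1` Q)); last first.
  by apply/seteqP; split=> x /=; rewrite /= swap_wordK.
apply: (gibbs_preimage_le (N := N) mu_phi) => //.
- by move=> x _; exact: iter_swap_word.
- exact: swap_word_gibbs.
- by rewrite -[X in measurable X]setTI; exact: (swap_word_measurable abN).
- by move=> x /Qc; rewrite swap_wordK.
Qed.

Lemma connect_cylinder : aperiodic_mx A -> exists p, forall x y M q, (p <= q)%N ->
  exists2 z, cylinder x M z & iter (M + q) sft_shift z = y.
Proof.
move=> aperA; have [p prim] := paths_primitive irrA aperA.
exists p => x y [|M] q pq.
  by have [z [xz zy]] := sft_connect x 0 y prim pq; exists z.
(* [sft_connect] counts from the position of the last prescribed letter, hence a path of length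
   [q.+1]. *)
have [z [xz zy]] := sft_connect x M y prim (leq_trans pq (leqnSn q)).
by exists z; rewrite // addSnnS.
Qed.

Lemma mu_le_card_fibers (I : finType) (P : set (sft irrA)) (g : sft irrA -> I)
    (c : \bar R) : (0 <= c)%E -> measurable P -> (forall i, measurable (g @^-1` [set i])) ->
    (forall i, (mu (P `&` g @^-1` [set i]) <= c)%E) ->
  (mu P <= #|I|%:R%:E * c)%E.
Proof.
move=> c0 mP mg Pc.
have mF i : measurable (P `&` g @^-1` [set i]) by exact: measurableI.
rewrite {1}(_ : P = \big[setU/set0]_(i <- enum I) (P `&` g @^-1` [set i])); last first.
  apply/seteqP; split=> x.
    by move=> Px; rewrite -bigcup_seq; exists (g x) => //=; rewrite mem_enum.
  by rewrite -bigcup_seq => -[i _ []].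
rewrite cardT; elim: (enum I) => [|i s IHs]; first by rewrite big_nil measure0 mul0e.
rewrite big_cons; apply: le_trans (measureU2 _ _ _) _ => //.
  by apply: bigsetU_measurable.
by rewrite /= -natr1 EFinD ge0_muleDl ?lee_fin// mul1e addeC; exact: leeD.
Qed.

(** Cut [cylinder x m] according to the next [L + p + 1] letters and swap each piece into
    [cylinder y (m + L)]. The first [m] letters contribute distortion at most [V] and the rest at
    most [(L + p) M], so [delta] does not depend on [m]. *)
Lemma cylinder_extend_ge : aperiodic_mx A -> exists2 delta : nat -> R,
  forall L, 0 < delta L &
  forall x m L y, cylinder x m y ->
    ((delta L)%:E * mu (cylinder x m) <= mu (cylinder y (m + L)%N))%E.
Proof.
move=> aperA; have [p con] := connect_cylinder aperA.
have [V V0 HV] := birkhoff_variation phi_sv.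
have [M M0 HM] := birkhoff_oscillation phi_sv.
pose c L : R := V + (L + p)%:R * M.
pose k L := #|{ffun 'I_(L + p).+1 -> 'I_n.+1}|%:R : R.
have k0 L : 0 < k L.
  by rewrite /k ltr0n card_ffun expn_gt0 card_ord.
have kc0 L : 0 < k L * expR (c L) by rewrite mulr_gt0// expR_gt0.
exists (fun L => (k L * expR (c L))^-1) => [L|x m L y xy]; first by rewrite invr_gt0.
suff H : (mu (cylinder x m) <= (k L * expR (c L))%:E * mu (cylinder y (m + L)))%E.
  by rewrite lee_pdivrMl.
pose g z : {ffun 'I_(L + p).+1 -> 'I_n.+1} := [ffun i : 'I__ => sft_coord z (m + i)].
have gfr i : finite_range (g @^-1` [set i]) (m + (L + p).+1).
  move=> u v uv /= <-; apply/ffunP => j; rewrite !ffunE uv//.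
  by have := ltn_ord j; lia.
rewrite EFinM -muleA; apply: (mu_le_card_fibers (g := g)).
- by rewrite mule_ge0// lee_fin expR_ge0.
- exact: cylinder_measurable.
- by move=> i; exact: finite_range_measurable (gfr i).
move=> i; have [->|/set0P[z [xz zi]]] := eqVneq (cylinder x m `&` g @^-1` [set i]) set0.
  by rewrite measure0 mule_ge0// lee_fin expR_ge0.
pose N := (m + (L + p))%N.
(* [z'] starts with [m + L] letters of [y] and uses [p] further letters to reach the tail of [z]. *)
have [z' yz' z'z] := con y (iter N sft_shift z) (m + L)%N p (leqnn _).
have zz'N : sft_coord z N = sft_coord z' N.
  by rewrite -[in LHS](addn0 N) -[in RHS](addn0 N) -!sft_coord_iter -z'z /N addnA.
have -> : cylinder x m `&` g @^-1` [set i] = cylinder z N.+1.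
  apply/seteqP; split=> u.
    move=> [xu /= ui] l lN; have [lm|ml] := ltnP l m; first by rewrite xu// xz.
    have lmN : (l - m < (L + p).+1)%N by move: lN; rewrite /N; lia.
    have /ffunP/(_ (Ordinal lmN)) : g u = g z by rewrite ui zi.
    by rewrite !ffunE/= subnKC.
  move=> zu; split.
    apply: cylinder_trans xz _; apply: sub_cylinder zu; rewrite /N; lia.
  apply: gfr zi; apply: sub_cylinder zu; rewrite /N; lia.
apply: (@le_trans _ _ ((expR (c L))%:E * mu (swap_word z z' N @^-1` cylinder z N.+1))%E).
  apply: swap_measure_le => //; first exact: cylinder_measurable.
  move=> u zu; have z'u := cylinder_swap_l zz'N zu.
  rewrite /N !(birkhoffD phi m) opprD addrACA; apply: lerD; last exact: HM.
  apply: HV; apply: (cylinder_trans (y := x)).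
    apply: cylinder_sym; apply: cylinder_trans xz _; apply: sub_cylinder zu.
    by rewrite /N; lia.
  apply: cylinder_trans xy _; apply: cylinder_trans (sub_cylinder _ yz') _; first by lia.
  by apply: sub_cylinder z'u; rewrite /N; lia.
apply: lee_wpmul2l; first by rewrite lee_fin expR_ge0.
apply: le_mu; first 2 last.
- move=> u zu; apply: cylinder_trans yz' _.
  apply: (@sub_cylinder _ _ _ _ _ N.+1); first by rewrite /N; lia.
  by have := cylinder_swap_l zz'N zu; rewrite swap_wordK.
- rewrite -[X in measurable X]setTI; apply: (swap_word_measurable zz'N) => //.
  exact: cylinder_measurable.
- exact: cylinder_measurable.
Qed.

Lemma cylinder_gt0 : aperiodic_mx A -> forall x N, (0 < mu (cylinder x N))%E.
Proof.
move=> /cylinder_extend_ge[delta d0 dP] x N.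
apply: lt_le_trans (dP x 0%N N x _) => //.
have -> : cylinder x 0 = setT by apply/seteqP; split.
by rewrite probability_setT mule1 lte_fin.
Qed.

(** A substitute for a density theorem: if every cylinder of length [m] lost more than the
    proportion [eta] outside [Y], so would a finite-range approximation [D] of [Y], forcing [mu D]
    to be small. *)
Lemma cylinder_density Y (eta : R) : measurable Y -> mu Y <> 0%E -> 0 < eta ->
  exists M, forall m, (M <= m)%N -> exists x,
    (mu (cylinder x m `\` Y) <= eta%:E * mu (cylinder x m))%E.
Proof.
move=> mY Y0 eta0.
have Yfin : mu Y \is a fin_num by rewrite fin_num_measure.
have fY0 : 0 < fine (mu Y).
  by rewrite -lte_fin fineK//; exact: mu_gt0P.
(* Chosen so that the bound [(eta^-1 + 1) * e] obtained for [mu Y] is half of [mu Y]. *)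
pose e := fine (mu Y) / (2 * (eta^-1 + 1)).
have eta1 : 0 < eta^-1 + 1 by rewrite addr_gt0 ?invr_gt0.
have e0 : 0 < e by rewrite divr_gt0// mulr_gt0.
have [M [D [DM YD]]] := finite_range_approx mu mY e0.
have mD := finite_range_measurable DM.
have mDY : measurable (D `\` Y) by exact: measurableD.
have mYD : measurable (Y `\` D) by exact: measurableD.
have DYe : (mu (D `\` Y) <= e%:E)%E.
  by apply: le_trans YD; apply: le_mu => //; do ?exact: measurableU; move=> ?; right.
have YDe : (mu (Y `\` D) <= e%:E)%E.
  by apply: le_trans YD; apply: le_mu => //; do ?exact: measurableU; move=> ?; left.
exists M => m Mm; apply: contrapT => /forallNP nx.
pose g z : {ffun 'I_m -> 'I_n.+1} := [ffun i : 'I_m => sft_coord z i].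
have gcyl z : g @^-1` [set g z] = cylinder z m.
  apply/seteqP; split=> u.
    by move=> /= /ffunP gu k km; have := gu (Ordinal km); rewrite !ffunE.
  by move=> zu; apply/ffunP => k; rewrite !ffunE zu.
have mg i : measurable (g @^-1` [set i]).
  have [->//|/set0P[z zi]] := eqVneq (g @^-1` [set i]) set0.
  by rewrite -zi gcyl; exact: cylinder_measurable.
have DK : (mu D <= (eta^-1)%:E * mu (D `\` Y))%E.
  apply: (le_mu_fibers (g := g) (h := g)) => //; first by rewrite invr_ge0 ltW.
  move=> i; have [->|/set0P[z [Dz <-]]] := eqVneq (D `&` g @^-1` [set i]) set0.
    by rewrite measure0 mule_ge0// lee_fin invr_ge0 ltW.
  rewrite gcyl lee_pdivlMl//.
  have zD : cylinder z m `<=` D by move=> u /(sub_cylinder Mm) /DM; exact.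
  have -> : D `&` cylinder z m = cylinder z m.
    by apply/seteqP; split=> u; [case|move=> zu; split=> //; exact: zD].
  have -> : (D `\` Y) `&` cylinder z m = cylinder z m `\` Y.
    by apply/seteqP; split=> u; [case=> -[? ?] ?|move=> [zu ?]; split=> //; split=> //; exact: zD].
  by have /negP := nx z; rewrite -ltNge => /ltW.
have : (mu Y <= (eta^-1 * e + e)%:E)%E.
  apply: (@le_trans _ _ (mu (D `|` (Y `\` D)))).
    apply: le_mu => //; first exact: measurableU.
    by move=> u Yu; have [?|?] := pselect (D u); [left|right].
  apply: le_trans (measureU2 _ _ _) _ => //; rewrite EFinD leeD//.
  apply: le_trans DK _; rewrite EFinM lee_wpmul2l// lee_fin invr_ge0 ltW//.
rewrite -(fineK Yfin) lee_fin -[X in _ + X]mul1r -mulrDl leNgt => /negP; apply.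
rewrite /e; move: (_ + 1) eta1 => t t0.
have -> : t * (fine (mu Y) / (2 * t)) = fine (mu Y) / 2.
  by field; rewrite gt_eqF.
by rewrite ltr_pdivrMr// ltr_pMr// ltr1n.
Qed.

(** Were this set not null, it would nearly fill some cylinder; but extending that cylinder by a
    connecting word and then by the first [r] letters of [w] gives a subcylinder of definite
    proportion that misses the set. *)
Lemma cylinder_recurrence : aperiodic_mx A -> forall w r m,
  mu [set x | forall N, (m <= N)%N -> ~ cylinder w r (iter N sft_shift x)] = 0%E.
Proof.
move=> aperA w r m0; set Y := [set x | _].
have mY : measurable Y.
  rewrite (_ : Y = \bigcap_N [set x | (m0 <= N)%N -> ~ cylinder w r (iter N sft_shift x)]).
    apply: bigcapT_measurable => N; apply: (@finite_range_measurable _ _ _ _ (N + r)).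
    move=> x y xy /= xw mN yw; apply: xw => //; apply: cylinder_trans yw _.
    exact/cylinder_sym/cylinder_iter.
  by apply/seteqP; split=> x xY N => [_|]; apply: xY.
apply: contrapT => Y0; have [delta d0 dP] := cylinder_extend_ge aperA.
have [p con] := connect_cylinder aperA.
have [|M MP] := @cylinder_density Y (delta (p + r)%N / 2) mY Y0.
  by rewrite divr_gt0.
have [x] := MP (maxn M m0) (leq_maxl _ _); set m := maxn M m0 => xY.
have [y xy yw] := con x w m p (leqnn p).
have := le_trans (dP x m (p + r)%N y xy) (le_trans _ xY).
have mc k z : measurable (cylinder z k) by exact: cylinder_measurable.
have ysub : cylinder y (m + (p + r)) `<=` cylinder x m `\` Y.
  move=> z yz; split; first by apply: cylinder_trans xy _; apply: sub_cylinder yz; lia.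
  move=> /(_ (m + p)%N) zY; apply: zY; first by rewrite /m; lia.
  by rewrite -yw; apply: cylinder_iter; rewrite -addnA.
move=> /(_ (le_mu mu (mc _ _) (measurableD (mc _ _) mY) ysub)).
have xfin : mu (cylinder x m) \is a fin_num by rewrite fin_num_measure.
have fx0 : 0 < fine (mu (cylinder x m)).
  by rewrite -lte_fin fineK// cylinder_gt0.
rewrite -(fineK xfin) -!EFinM lee_fin ler_pM2r// leNgt => /negP; apply.
by rewrite ltr_pdivrMr// ltr_pMr// ltr1n.
Qed.

End cylinder_estimates.

(** * Skew products and finite conjugacy classes *)

Section skew_products.
Context n (A : 'M[bool]_n.+1) (irrA : irreducible_mx A) (G : groupType).
Variable psi : sft irrA -> G.
Implicit Types (x y z u w : sft irrA) (g h : G).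
Local Open Scope group_scope.

Definition psi_prod N x : G := \big[*%g/1%g]_(0 <= k < N) psi (iter k sft_shift x).

Lemma psi_prodD N M x :
  psi_prod (N + M) x = psi_prod N x * psi_prod M (iter N sft_shift x).
Proof.
rewrite /psi_prod (@big_cat_nat _ _ _ N)//= ?leq_addr//; congr (_ * _).
have -> (F : nat -> G) :
    \big[*%g/1%g]_(N <= k < N + M) F k = \big[*%g/1%g]_(0 <= k < M) F (k + N)%N.
  by rewrite -{1}[N]add0n big_addn addKn.
by apply: eq_bigr => k _; rewrite iterD.
Qed.

Lemma psi_prod_finite_range r N x y : (forall x y, cylinder x r y -> psi y = psi x) ->
  cylinder x (N + r) y -> psi_prod N y = psi_prod N x.
Proof.
move=> psir xy; apply: eq_big_nat => k /andP[_ kN]; apply: psir.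
by apply: cylinder_iter; apply: sub_cylinder xy; lia.
Qed.

Lemma skew_relationP x y : skew_relation psi (x, y) <->
  exists N, iter N sft_shift x = iter N sft_shift y /\ psi_prod N x = psi_prod N y.
Proof.
split=> [[Rxy Jxy]|[N [xyN psixy]]].
  have [N _ NJ] := cocycleP psi Rxy; move/gibbs_relationP : Rxy => [M xyM].
  (* [cocycle_seq] at [K] is a quotient of products of [K.+1] factors. *)
  exists (maxn N M).+1; split.
    have -> : (maxn N M).+1 = ((maxn N M).+1 - M + M)%N by lia.
    by rewrite !iterD xyM.
  have := NJ (maxn N M) (leq_maxl _ _); rewrite Jxy /cocycle_seq/= => J1.
  by apply: (mulIg (psi_prod (maxn N M).+1 y)^-1); rewrite mulgV.
have Rxy : gibbs_relation irrA (x, y) by apply/gibbs_relationP; exists N.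
split=> //; have [M _ MJ] := cocycleP psi Rxy.
rewrite -(MJ (maxn N M)) /=; last exact: leq_maxr.
rewrite /cocycle_seq/= -!/(psi_prod _ _).
have -> : (maxn N M).+1 = (N + ((maxn N M).+1 - N))%N by lia.
by rewrite !psi_prodD psixy xyN mulgV.
Qed.

Definition commutes_with_values g := forall x, g * psi x = psi x * g.

Lemma commutes_prod g N x : commutes_with_values g -> g * psi_prod N x = psi_prod N x * g.
Proof.
move=> gc; elim: N => [|N IHN]; first by rewrite /psi_prod big_geq// mulg1 mul1g.
by rewrite -addn1 psi_prodD mulgA IHN -!mulgA; congr (_ * _); rewrite /psi_prod big_nat1 gc.
Qed.

Lemma commutesM g h : commutes_with_values g -> commutes_with_values h ->
  commutes_with_values (g * h).
Proof. by move=> gc hc x; rewrite -mulgA hc !mulgA gc. Qed.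

Lemma commutesX g k : commutes_with_values g -> commutes_with_values (g ^+ k).
Proof.
move=> gc; elim: k => [|k IHk]; first by move=> x; rewrite expg0 mulg1 mul1g.
by rewrite expgS; exact: commutesM.
Qed.

(* [c g] records the conjugation action of [g] on the values of [psi]. *)
Lemma conjugation_types r : finite_conjugacy_classes G ->
    (forall x y, cylinder x r y -> psi y = psi x) ->
  exists (T : finType) (c : G -> T), forall g h, c g = c h ->
    commutes_with_values (h^-1 * g).
Proof.
move=> fcG psir.
have types (s : seq G) : exists (T : finType) (c : G -> T), forall g h, c g = c h ->
    forall k, k \in s -> g * k * g^-1 = h * k * h^-1.
  elim: s => [|k s [T [c cP]]]; first by exists unit, (fun=> tt).
  (* [f] numbers the finite conjugacy class of [k], and the new component of the type of [g] is the
     number of its conjugate by [g]. *)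
  have /finite_setP[m /card_set_bijP[f fbij]] := fcG k.
  have fm g : (f (g * k * g^-1)%g < m)%N by apply: (set_bij_homo fbij); exists g.
  exists (T * 'I_m)%type, (fun g => (c g, Ordinal (fm g))) => g h [cgh fgh] l.
  rewrite inE => /predU1P[->|]; last exact: cP.
  by apply: (set_bij_inj fbij) => //; apply: mem_set; [exists g|exists h].
(* Every value of [psi] is attained at a representative of one of the finitely many words of length
   [r]. *)
pose rep (i : {ffun 'I_r -> 'I_n.+1}) : sft irrA :=
  xget point [set x | forall k : 'I_r, sft_coord x k = i k].
have [T [c cP]] := types [seq psi (rep i) | i <- enum {ffun 'I_r -> 'I_n.+1}].
exists T, c => g h cgh x.
pose i := [ffun k : 'I_r => sft_coord x k].
have psix : psi x = psi (rep i).
  apply: psir; have : [set x | forall k : 'I_r, sft_coord x k = i k] (rep i).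
    apply: (@xgetI _ _ [set x | forall k : 'I_r, sft_coord x k = i k] x).
    by move=> k; rewrite ffunE.
  by move=> repi k kr; rewrite (repi (Ordinal kr)) ffunE.
have : psi x \in [seq psi (rep i) | i <- enum {ffun 'I_r -> 'I_n.+1}].
  by rewrite psix; apply: map_f; rewrite mem_enum.
move=> /(cP _ _ cgh) /(congr1 (fun k => h^-1 * k * g)).
by rewrite -!mulgA mulVg mulg1 mulKg => ->.
Qed.

(** Among the powers of [g] with exponents from [0] to [#|T|] two have the same type. Their
    exponents differ by at most [#|T|], hence by a divisor of the factorial of [#|T|], which is
    [K.+1]. *)
Lemma uniform_exponent (T : finType) (c : G -> T) :
    (forall g h, c g = c h -> commutes_with_values (h^-1 * g)) ->
  exists K, forall g, commutes_with_values (g ^+ K.+1).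
Proof.
move=> cP; exists ((factorial #|T|)).-1 => g; rewrite prednK ?fact_gt0//.
have [i [j [ij cij]]] : exists i j : 'I_#|T|.+1, (i < j)%N /\ c (g ^+ i) = c (g ^+ j).
  have /injectivePn[i [j ij cij]] : ~~ injectiveb (fun i : 'I_#|T|.+1 => c (g ^+ i)).
    apply/negP => /injectiveP /leq_card; rewrite card_ord ltnn//.
  have [lt|lt|/val_inj eq] := ltngtP i j; first by exists i, j.
  - by exists j, i.
  - by rewrite eq eqxx in ij.
have := cP _ _ (esym cij).
have -> : (g ^+ i)^-1 * g ^+ j = g ^+ (j - i).
  by apply: (mulgI (g ^+ i)); rewrite mulVKg -expgnDr subnKC// ltnW.
move=> gc; have /dvdnP[k ->] : (j - i %| (factorial #|T|))%N.
  by apply: dvdn_fact; have := ltn_ord j; lia.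
by rewrite mulnC expgnA; exact: commutesX.
Qed.

(** * Loops at a fixed word and their central extensions *)

Section loops.
Variables (w : sft irrA) (r : nat).
Hypotheses (r_gt0 : (0 < r)%N) (psir : forall x y, cylinder x r y -> psi y = psi x).

(** Only the first [N + r] letters of [z] matter; the point need not be periodic. *)
Definition is_loop z N := cylinder w r z /\ cylinder w r (iter N sft_shift z).

Lemma loop_cat z N y : is_loop z N -> cylinder w r y ->
  cylinder z (N + r) (sft_cat z N y) /\ iter N sft_shift (sft_cat z N y) = y.
Proof.
move=> [wz wNz] wy.
have zy : sft_coord z N = sft_coord y 0.
  by rewrite wy// -(wNz 0%N)// sft_coord_iter addn0.
split; last exact: iter_sft_cat.
rewrite -(prednK r_gt0); apply: cylinder_catD; rewrite prednK//.
exact: cylinder_trans (cylinder_sym wNz) wy.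
Qed.

Lemma cylinder_loop z N x : is_loop z N -> cylinder z (N + r) x ->
  cylinder w r x /\ cylinder w r (iter N sft_shift x).
Proof.
move=> [wz wNz] zx; split.
  by apply: cylinder_trans wz _; apply: sub_cylinder zx; exact: leq_addl.
exact: cylinder_trans wNz (cylinder_iter zx).
Qed.

Lemma loop_power z N j : is_loop z N -> exists2 y, cylinder w r y &
  iter (N * j) sft_shift y = w /\ psi_prod (N * j) y = psi_prod N z ^+ j.
Proof.
move=> zN; elim: j => [|j [y wy [yw psiy]]].
  by exists w => //; rewrite muln0 /psi_prod big_geq.
have [zy yN] := loop_cat zN wy; exists (sft_cat z N y).
  by have [] := cylinder_loop zN zy.
rewrite mulnS addnC iterD addnC psi_prodD yN; split=> //.
by rewrite (psi_prod_finite_range psir zy) psiy expgS.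
Qed.

(** Each loop is followed by [K] copies of a loop of the same conjugation type. For every pair of
    types a single length [f t] is fixed at which both occur, so both extensions have the same
    length; finiteness of the set of pairs bounds it. *)
Lemma common_central_extension : finite_conjugacy_classes G ->
  exists Lmax, forall N z z', is_loop z N -> is_loop z' N ->
  exists2 L, (L <= Lmax)%N & exists y y', [/\
    cylinder z (N + r) y /\ cylinder z' (N + r) y',
    is_loop y (N + L) /\ is_loop y' (N + L),
    commutes_with_values (psi_prod (N + L) y) &
    commutes_with_values (psi_prod (N + L) y')].
Proof.
move=> fcG; have [T [c cP]] := conjugation_types fcG psir.
have [K KP] := uniform_exponent cP.
pose P (t : T * T) N := exists u u', [/\ is_loop u N, is_loop u' N,
  c (psi_prod N u) = t.1 & c (psi_prod N u') = t.2].
have /choice[f fP] (t : T * T) : exists N, (exists N, P t N) -> P t N.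
  by have [[N PN]|nP] := pselect (exists N, P t N); [exists N|exists 0%N].
exists (\max_t (f t * K))%N => N z z' zN z'N.
pose t := (c (psi_prod N z), c (psi_prod N z')).
have [u [u' [uN u'N cu cu']]] : P t (f t) by apply: fP; exists N, z, z'.
exists (f t * K)%N; first exact: (@leq_bigmax_cond _ predT (fun t => (f t * K)%N)).
have ext x v : is_loop x N -> is_loop v (f t) ->
    c (psi_prod (f t) v) = c (psi_prod N x) -> exists y,
    [/\ cylinder x (N + r) y, is_loop y (N + f t * K) &
      commutes_with_values (psi_prod (N + f t * K) y)].
  move=> xN vf cvx; have [y wy [yw psiy]] := loop_power K vf.
  have [xy yN] := loop_cat xN wy; have [wxy _] := cylinder_loop xN xy.
  exists (sft_cat x N y); split=> //.
    by split=> //; rewrite addnC iterD yN yw.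
  rewrite psi_prodD yN psiy (psi_prod_finite_range psir xy).
  set g := psi_prod N x; set h := psi_prod (f t) v.
  have hg : commutes_with_values (h^-1 * g) by exact: cP.
  (* Equality of types makes [h^-1 * g] commute with the values of [psi], hence with their product
     [h]; both factors on the right are then central for these values. *)
  have -> : g * h ^+ K = h ^+ K.+1 * (h^-1 * g).
    have hgX k : (h^-1 * g) * h ^+ k = h ^+ k * (h^-1 * g).
      elim: k => [|k IHk]; first by rewrite expg0 mulg1 mul1g.
      by rewrite expgS mulgA commutes_prod// -mulgA IHk mulgA.
    by rewrite expgS -mulgA -hgX mulgA mulVKg.
  by apply: commutesM => //; exact: KP.
have [y [zy yN cy]] := ext z u zN uN cu.
have [y' [zy' yN' cy']] := ext z' u' z'N u'N cu'.
by exists y, y'.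
Qed.

End loops.

End skew_products.

(** * Ergodicity inside a cylinder *)

Section return_words.
Context n (A : 'M[bool]_n.+1) (irrA : irreducible_mx A).
Variables (w : sft irrA) (r m : nat).
Implicit Types x y z : sft irrA.

Definition returns z N := (m <= N)%N /\ cylinder w r (iter N sft_shift z).

Lemma returns_cylinder z z' N : cylinder z (N + r) z' -> returns z N -> returns z' N.
Proof. by move=> zz' [mN wz]; split=> //; exact: cylinder_trans wz (cylinder_iter zz'). Qed.

Definition sft_word z k : seq 'I_n.+1 := [seq sft_coord z i | i <- iota 0 k].

Lemma sft_word_cylinder z z' k : sft_word z k = sft_word z' k <-> cylinder z k z'.
Proof.
split=> [zz' i ik|zz'].
  by have /(congr1 (fun s => nth ord0 s i)) := zz'; rewrite /sft_word
    !(nth_map 0%N) ?size_iota// nth_iota// add0n.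
by apply/eq_in_map => i; rewrite mem_iota add0n => /andP[_ ik]; rewrite zz'.
Qed.

(* The initial word of [z] up to the end of the occurrence of [w_0 ... w_(r-1)]
   at the first return time after [m]. *)
Definition return_word z : option (seq 'I_n.+1) :=
  match pselect (exists N, `[< returns z N >]) with
  | left h => Some (sft_word z (ex_minn h + r))
  | right _ => None
  end.

Lemma return_wordP z s : return_word z = Some s <-> exists N,
  [/\ returns z N, forall N', returns z N' -> (N <= N')%N & s = sft_word z (N + r)].
Proof.
rewrite /return_word; case: pselect => [h|nh]; last first.
  by split=> // -[N [zN _ _]]; exfalso; apply: nh; exists N; apply/asboolP.
case: ex_minnP => N /asboolP zN Nmin; split=> [[<-]|[N' [zN' N'min ->]]].
  by exists N; split=> // N' /asboolP /Nmin.
have -> : N = N'; last by [].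
by apply/eqP; rewrite eqn_leq N'min// andbT Nmin//; apply/asboolP.
Qed.

Lemma return_word_None z : return_word z = None -> forall N, ~ returns z N.
Proof.
rewrite /return_word; case: pselect => // nh _ N zN.
by apply: nh; exists N; apply/asboolP.
Qed.

(** The first return is a stopping time: the letters of the return word decide it. *)
Lemma return_word_cylinder z z' s : return_word z = Some s ->
  cylinder z (size s) z' -> return_word z' = Some s.
Proof.
move=> /return_wordP[N [zN Nmin ->]]; rewrite size_map size_iota => zz'.
apply/return_wordP; exists N; split.
- exact: returns_cylinder zN.
- move=> N' zN'; rewrite leqNgt; apply/negP => N'N.
  suff : (N <= N')%N by rewrite leqNgt N'N.
  apply: Nmin; apply: returns_cylinder zN'; apply: cylinder_sym.
  by apply: sub_cylinder zz'; rewrite leq_add2r ltnW.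
- exact/sft_word_cylinder.
Qed.

Lemma return_word_measurable i : measurable (return_word @^-1` [set i]).
Proof.
have mS s : measurable (return_word @^-1` [set Some s]).
  by apply: (@finite_range_measurable _ _ _ _ (size s)) => x y xy /= /return_word_cylinder; apply.
case: i => [s|]; first exact: mS.
rewrite (_ : _ @^-1` _ = ~` (\bigcup_s return_word @^-1` [set Some s])).
  by apply: measurableC; apply: countable_bigcupT_measurable.
apply/seteqP; split=> x /=; first by move=> xN [s _ /=]; rewrite xN.
by case xs: return_word => [s|//] ns; case: ns; exists s.
Qed.

End return_words.

Lemma iter_sft_shift_measurable n (A : 'M[bool]_n.+1) (irrA : irreducible_mx A) N :
  measurable_fun setT (iter N (@sft_shift _ _ irrA)).
Proof.
apply: finite_range_fun_measurable => k; exists (N + k).+1 => x y xy.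
by rewrite !sft_coord_iter xy.
Qed.

Lemma cylinder_join n (A : 'M[bool]_n.+1) (irrA : irreducible_mx A) (x y : sft irrA) N M :
  cylinder x N y -> cylinder (iter N sft_shift x) M (iter N sft_shift y) ->
  cylinder x (N + M) y.
Proof.
move=> xy xyN k kNM; have [kN|Nk] := ltnP k N; first exact: xy.
by have := xyN (k - N)%N; rewrite !sft_coord_iter subnKC//; apply; lia.
Qed.

Section local_ergodicity.
Context n (A : 'M[bool]_n.+1) (irrA : irreducible_mx A) (R : realType).
Variables (phi : sft irrA -> R) (mu : probability (sft irrA) R).
Hypotheses (phi_sv : summable_variation phi) (mu_phi : gibbs_measure phi mu).
Hypothesis aperA : aperiodic_mx A.
Variables (G : groupType) (psi : sft irrA -> G) (w : sft irrA) (r : nat).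
Hypotheses (r_gt0 : (0 < r)%N) (psir : forall x y, cylinder x r y -> psi y = psi x).
Implicit Types (x y z u e : sft irrA) (B Q Y : set (sft irrA)).

Variable B : set (sft irrA).
Hypothesis mB : measurable B.
Hypothesis Binv : forall x y, cylinder w r x -> cylinder w r y ->
  skew_relation psi (x, y) -> B x -> B y.

(* Moves the word [E = x_0 ... x_(l-1)] of [x = E F y] behind the word [F] of
   length [N] and changes it to the word [e_0 ... e_(l-1)]. *)
Lemma swap_loop_behind (x0 e : sft irrA) l N :
    is_loop w r e l -> is_loop w r x0 l -> is_loop w r (iter l sft_shift x0) N ->
  exists b, sft_coord x0 (l + N) = sft_coord b (l + N) /\
    forall x, cylinder x0 (l + N + r) x -> let u := swap_word x0 b (l + N) x in
    cylinder (iter l sft_shift x0) (N + r) u /\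
    cylinder e (l + r) (iter N sft_shift u).
Proof.
move=> eL x0L zN; set z := iter l sft_shift x0.
pose y0 := iter N sft_shift z.
have wy0 : cylinder w r y0 by have [] := zN.
(* With [x0 = E F y0], the point [e'] is the word of [e] followed by [y0], and [b] is [F] followed
   by [e']. *)
have [ee' e'l] := loop_cat r_gt0 eL wy0; set e' := sft_cat e l y0 in ee' e'l.
have we' : cylinder w r e' by have [] := cylinder_loop eL ee'.
have [zb bN] := loop_cat r_gt0 zN we'; set b := sft_cat z N e' in zb bN.
have by0 : iter (l + N) sft_shift b = y0 by rewrite iterD bN e'l.
have xb : sft_coord x0 (l + N) = sft_coord b (l + N).
  rewrite -[in LHS](addn0 (l + N)%N) -[in RHS](addn0 (l + N)%N) -!sft_coord_iter by0.
  by rewrite /y0 /z -iterD addnC.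
exists b; split=> // x x0x /=.
have x0x1 : cylinder x0 (l + N).+1 x by apply: sub_cylinder x0x; lia.
set u := swap_word _ _ _ _.
have bu : cylinder b (l + N + r) u.
  apply: cylinder_join; first by apply: sub_cylinder (cylinder_swap_l xb x0x1).
  rewrite iter_swap_word// by0 /y0 /z -iterD addnC.
  exact: cylinder_iter x0x.
split; first by apply: cylinder_trans zb _; apply: sub_cylinder bu; lia.
apply: cylinder_trans ee' _; rewrite -bN; apply: cylinder_iter.
by apply: sub_cylinder bu; lia.
Qed.

Lemma swap_loop (e e' : sft irrA) l x : is_loop w r e l -> is_loop w r e' l ->
  sft_coord e l = sft_coord e' l /\ (cylinder e (l + r) x ->
  cylinder e' (l + r) (swap_word e e' l x)).
Proof.
move=> [we wel] [we' we'l].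
have ee' : sft_coord e l = sft_coord e' l.
  rewrite -[in LHS](addn0 l) -[in RHS](addn0 l) -!sft_coord_iter.
  by rewrite wel// we'l.
split=> // ex; have ex1 : cylinder e l.+1 x by apply: sub_cylinder ex; lia.
apply: cylinder_join; first by apply: sub_cylinder (cylinder_swap_l ee' ex1).
rewrite iter_swap_word//.
by apply: cylinder_trans (cylinder_sym we'l) _; apply: cylinder_trans wel (cylinder_iter ex).
Qed.

(* Let [x = e F y] and [x' = e' F y], where [F] is a return word of length at
   least [m].  Since the values of [e] and [e'] are central, [x] is equivalent to
   [F e y] and [x'] to [F e' y]; an approximation [D] of [B] by a set depending on
   [m] coordinates cannot tell these two points apart. *)
Lemma central_swap_invariant (e e' : sft irrA) l :
    is_loop w r e l -> is_loop w r e' l ->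
    commutes_with_values psi (psi_prod psi l e) ->
    commutes_with_values psi (psi_prod psi l e') ->
  mu (cylinder e (l + r) `&` B `&` swap_word e e' l @^-1` (~` B)) = 0%E.
Proof.
move=> eL e'L ce ce'; have [ee' _] := swap_loop e eL e'L.
set Bad := _ `&` _.
have mBad : measurable Bad.
  apply: measurableI; first by apply: measurableI => //; exact: cylinder_measurable.
  rewrite -[X in measurable X]setTI; apply: (swap_word_measurable ee') => //.
  exact: measurableC.
have [V V0 HV] := birkhoff_variation phi_sv.
have [M M0 HM] := birkhoff_oscillation phi_sv.
(* [V] accounts for the displaced but unaltered word [F] and [l%:R * M] for the other [l] letters;
   [c] does not involve the length of [F]. *)
pose c := V + l%:R * M.
apply: mu_eq0_small => // eps eps0.
pose K := 2 * expR c.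
have K0 : 0 < K by rewrite mulr_gt0 ?expR_gt0.
have [m [D [Dm BD]]] := finite_range_approx mu mB (divr_gt0 eps0 K0).
have mD := finite_range_measurable Dm.
set Q := _ `|` _ in BD.
have mQ : measurable Q by apply: measurableU; exact: measurableD.
suff BadQ : (mu Bad <= K%:E * mu Q)%E.
  apply: le_trans BadQ _; apply: (@le_trans _ _ (K%:E * (eps / K)%:E)%E).
    by rewrite lee_wpmul2l// lee_fin ltW.
  by rewrite -EFinM lee_fin mulrCA divff ?gt_eqF// mulr1.
pose g := return_word w r m.
have mg i : measurable (g @^-1` [set i]) by exact: return_word_measurable.
have mgl i : measurable ((g \o iter l sft_shift) @^-1` [set i]).
  rewrite comp_preimage -[X in measurable X]setTI.
  exact: (@iter_sft_shift_measurable _ _ irrA l).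
(* A point [e F y] shows its return word after [l] shifts, whereas [F e y] and [F e' y] show it at
   once; hence the two different cuts. *)
apply: (le_mu_fibers (g := g \o iter l sft_shift) (h := g)) => //; first exact: ltW.
move=> [s|]; last first.
  have null : (mu (Bad `&` (g \o iter l sft_shift) @^-1` [set None]) <= 0)%E.
    rewrite -(cylinder_recurrence phi_sv mu_phi aperA w r (l + m)).
    apply: le_mu; first exact: measurableI.
      rewrite (_ : [set x | _] = iter l sft_shift @^-1` (g @^-1` [set None])).
        by rewrite -[X in measurable X]setTI; exact: (@iter_sft_shift_measurable _ _ irrA l).
      apply/seteqP; split=> x /=.
        move=> xN; case gx : (g _) => [s|//].
        have /return_wordP[N [[mN wN] _ _]] := gx.
        case: (xN (N + l)%N); first lia.
        by rewrite iterD.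
      move=> /return_word_None xN N lN wN; apply: (xN (N - l)%N); split; first lia.
      by rewrite -iterD subnK//; lia.
    move=> x [_ /return_word_None xN] N lN wN; apply: (xN (N - l)%N); split; first lia.
    by rewrite -iterD subnK//; lia.
  apply: le_trans null _; rewrite mule_ge0// lee_fin ltW//.
have [->|/set0P[x0 [[[ex0 Bx0] _] /= gx0]]] :=
  eqVneq (Bad `&` (g \o iter l sft_shift) @^-1` [set Some s]) set0.
  by rewrite measure0 mule_ge0// lee_fin ltW.
pose z := iter l sft_shift x0.
have /return_wordP[N [zret _ sE]] := gx0.
have sizes : size s = (N + r)%N by rewrite sE size_map size_iota.
have x0L : is_loop w r x0 l by exact: cylinder_loop ex0.
have zN : is_loop w r z N by split; [case: x0L|case: zret].
have [b [x0b bP]] := swap_loop_behind eL x0L zN.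
have [b' [x0b' b'P]] := swap_loop_behind e'L x0L zN.
set P := Bad `&` _; have mP : measurable P by exact: measurableI.
have Px x : P x -> cylinder x0 (l + N + r) x.
  move=> [[[ex _] _] /= gx]; have xL := cylinder_loop eL ex.
  rewrite -addnA; apply: cylinder_join.
    apply: (@sub_cylinder _ _ _ _ _ (l + r)); first exact: leq_addr.
    exact: cylinder_trans (cylinder_sym ex0) ex.
  have /return_wordP[N' [_ _ sE']] := gx.
  have N'N : N' = N.
    by apply/eqP; rewrite -(eqn_add2r r) -sizes sE' size_map size_iota.
  by apply/sft_word_cylinder; rewrite -sE sE' N'N.
(* [P1 b] and [P1 b'] collect the points of [P] whose image [F e y], respectively [F e' y], falls
   into the error set [Q]; together they cover [P], whence the factor 2 in [K]. *)
pose P1 c := P `&` swap_word x0 c (l + N) @^-1` (Q `&` g @^-1` [set Some s]).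
have mP1 c' : sft_coord x0 (l + N) = sft_coord c' (l + N) -> measurable (P1 c').
  move=> xc; apply: measurableI => //; rewrite -[X in measurable X]setTI.
  by apply: (swap_word_measurable xc) => //; exact: measurableI.
have HP1 e1 c' : sft_coord x0 (l + N) = sft_coord c' (l + N) ->
    (forall x, cylinder x0 (l + N + r) x -> let u := swap_word x0 c' (l + N) x in
      cylinder z (N + r) u /\ cylinder e1 (l + r) (iter N sft_shift u)) ->
    (mu (P1 c') <= (expR c)%:E * mu (Q `&` g @^-1` [set Some s]))%E.
  move=> xc cP.
  apply: (@le_trans _ _ ((expR c)%:E * mu (swap_word x0 c' (l + N) @^-1` P1 c'))%E).
    apply: (swap_measure_le mu_phi) => //; first exact: mP1.
    move=> x [/Px x0x _]; have [zu _] := cP x x0x.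
    rewrite birkhoffD [X in birkhoff phi X (swap_word _ _ _ _)]addnC birkhoffD opprD.
    rewrite [- _ - _]addrC addrACA /c [V + _]addrC; apply: lerD; first exact: HM.
    apply: HV; apply: (@cylinder_trans _ _ _ _ z).
      apply: cylinder_sym; apply: cylinder_iter.
      by apply: sub_cylinder x0x; exact: leq_addr.
    by apply: sub_cylinder zu; exact: leq_addr.
  rewrite lee_wpmul2l ?lee_fin ?expR_ge0//; apply: le_mu.
  - rewrite -[X in measurable X]setTI; apply: (swap_word_measurable xc) => //.
    exact: mP1.
  - exact: measurableI.
  - by move=> x [_]; rewrite /= swap_wordK.
apply: (@le_trans _ _ (mu (P1 b `|` P1 b'))); last first.
  apply: le_trans (measureU2 _ _ _) _; try exact: mP1.
  by rewrite /K [2]mulr2n mulrDl mul1r EFinD ge0_muleDl ?lee_fin ?expR_ge0// leeD//;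
    [exact: HP1 bP|exact: HP1 b'P].
apply: le_mu => //; first by apply: measurableU; exact: mP1.
move=> x Pxx; have x0x := Px _ Pxx; move: (Pxx) => [[[ex Bx] nBx] gx].
set u := swap_word x0 b (l + N) x; set u' := swap_word x0 b' (l + N) x.
have [zu eu] := bP x x0x; have [zu' eu'] := b'P x x0x; rewrite -/u -/u' in zu eu zu' eu'.
have uN : iter (l + N) sft_shift u = iter (l + N) sft_shift x by exact: iter_swap_word.
have u'N : iter (l + N) sft_shift u' = iter (l + N) sft_shift x by exact: iter_swap_word.
set t := swap_word e e' l x.
have tl : iter l sft_shift t = iter l sft_shift x by exact: iter_swap_word.
have et : cylinder e' (l + r) t by have [_] := swap_loop x eL e'L; apply.
have tN : iter (l + N) sft_shift t = iter (l + N) sft_shift x.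
  by rewrite addnC !iterD tl.
have zx : cylinder z (N + r) (iter l sft_shift x).
  by apply: cylinder_iter; rewrite addnA.
have [wx _] := cylinder_loop eL ex; have [wt _] := cylinder_loop e'L et.
have [wu _] := cylinder_loop zN zu; have [wu' _] := cylinder_loop zN zu'.
have prodE v e1 : cylinder e1 (l + r) v -> cylinder z (N + r) (iter l sft_shift v) ->
    psi_prod psi (l + N) v = (psi_prod psi l e1 * psi_prod psi N z)%g.
  move=> ev zv; rewrite psi_prodD.
  by rewrite (psi_prod_finite_range psir ev) (psi_prod_finite_range psir zv).
have prodE' v e1 : cylinder z (N + r) v -> cylinder e1 (l + r) (iter N sft_shift v) ->
    psi_prod psi (l + N) v = (psi_prod psi N z * psi_prod psi l e1)%g.
  move=> zv ev; rewrite addnC psi_prodD.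
  by rewrite (psi_prod_finite_range psir zv) (psi_prod_finite_range psir ev).
have Bu : B u.
  apply: (Binv wx wu _ Bx); apply/skew_relationP; exists (l + N)%N; split=> //.
  by rewrite (prodE x e)// (prodE' u e)// commutes_prod.
have nBu' : ~ B u'.
  move=> Bu'; apply: nBx; apply: (Binv wu' wt _ Bu').
  apply/skew_relationP; exists (l + N)%N; split; first by rewrite u'N tN.
  by rewrite (prodE t e') ?tl// (prodE' u' e')//; exact/esym/commutes_prod.
have gu v : cylinder z (N + r) v -> g v = Some s.
  by move=> zv; apply: return_word_cylinder gx0 _; rewrite sizes.
have [mN _] := zret.
(* [u] and [u'] agree in their first [m] letters, so [D] contains both or neither; since only [u]
   lies in [B], one of them is in [Q]. *)
have [Du|Du] := pselect (D u).
  right; split=> //; split=> /=; last exact: gu.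
  right; split=> //; apply: Dm Du; apply: cylinder_trans (cylinder_sym (sub_cylinder _ zu)) _.
    by lia.
  by apply: sub_cylinder zu'; lia.
by left; split=> //; split=> /=; [left|exact: gu].
Qed.

(** If both parts had positive measure, two words of equal length would be nearly filled by one and
    by the other. Bounded extension to central loops keeps the densities, and the swap of these
    loops would carry much of [B] into its complement, against [central_swap_invariant]. *)
Lemma local_ergodicity : finite_conjugacy_classes G ->
  mu (cylinder w r `&` B) = 0%E \/ mu (cylinder w r `&` ~` B) = 0%E.
Proof.
move=> fcG; apply: contrapT => /not_orP[B0 nB0].
have [delta d0 dP] := cylinder_extend_ge phi_sv mu_phi aperA.
have [p con] := connect_cylinder irrA aperA.
have [Lmax HL] := common_central_extension w r_gt0 psir fcG.
have [V V0 HV] := birkhoff_variation phi_sv.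
(* [dm] bounds the loss of measure over all extensions that may occur: [p] letters to reach [w], at
   most [Lmax] to become central, and [r] to close the loop. *)
have [dm dm0 dmP] : exists2 dm : R, 0 < dm & forall L, (L <= Lmax)%N -> dm <= delta (p + (L + r))%N.
  elim: (Lmax) => [|L [dm dm0 dmP]].
    by exists (delta (p + (0 + r))%N) => // L; rewrite leqn0 => /eqP ->.
  exists (Num.min dm (delta (p + (L.+1 + r))%N)); first by rewrite lt_min dm0 d0.
  move=> L'; rewrite leq_eqVlt ltnS => /predU1P[->|/dmP]; rewrite ge_min ?lexx ?orbT//.
  by move=> ->.
pose E := expR (4 * V).
have E0 : 0 < E by exact: expR_gt0.
(* The first bound makes each selected cylinder meet its set; the second keeps the exceptional part
   of the cylinder of [y], at most [eta / dm * (1 + E)] of it, within one half. *)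
pose eta := Num.min 2^-1 (dm / (2 * (1 + E))).
have eta0 : 0 < eta by rewrite lt_min invr_gt0 ltr0n divr_gt0// mulr_gt0// addr_gt0.
have eta1 : eta < 1 by rewrite gt_min invf_lt1// ltr1n.
have etadm : eta / dm * (1 + E) <= 2^-1.
  have : eta <= dm / (2 * (1 + E)) by rewrite ge_min lexx orbT.
  rewrite ler_pdivlMr ?mulr_gt0 ?addr_gt0// => etaE.
  rewrite mulrAC ler_pdivrMr//; lra.
have mC : measurable (cylinder w r) by exact: cylinder_measurable.
have mcyl x N : measurable (cylinder x N) by exact: cylinder_measurable.
have mCB : measurable (cylinder w r `&` B) by exact: measurableI.
have mCnB : measurable (cylinder w r `&` ~` B) by apply: measurableI => //; exact: measurableC.
have [M1 HM1] := cylinder_density mCB B0 eta0.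
have [M2 HM2] := cylinder_density mCnB nB0 eta0.
pose m := maxn r (maxn M1 M2).
have [|x xB] := HM1 m; first by rewrite /m; lia.
have [|x' x'B] := HM2 m; first by rewrite /m; lia.
have fin S : mu S \is a fin_num -> exists2 a : R, 0 <= a & mu S = a%:E.
  by move=> Sfin; exists (fine (mu S)); rewrite ?fine_ge0// fineK.
have finm S : measurable S -> exists2 a : R, 0 <= a & mu S = a%:E.
  by move=> mS; apply: fin; rewrite fin_num_measure.
have lt_cyl x0 (S : set (sft irrA)) : measurable S ->
    (mu (cylinder x0 m `\` S) <= eta%:E * mu (cylinder x0 m))%E ->
    exists2 y, cylinder x0 m y & S y.
  move=> mS x0S; apply: contrapT => nS.
  have : cylinder x0 m `\` S = cylinder x0 m.
    by apply/seteqP; split=> y; [case|move=> xy; split=> // Sy; apply: nS; exists y].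
  move=> Sx; move: x0S; rewrite Sx.
  have := cylinder_gt0 phi_sv mu_phi aperA x0 m.
  have [a a0 ->] := finm _ (mcyl x0 m).
  by rewrite -EFinM lee_fin lte_fin => a_gt0; rewrite ler_pMl// leNgt eta1.
have loop x0 S : measurable (cylinder w r `&` S) ->
    (mu (cylinder x0 m `\` (cylinder w r `&` S)) <= eta%:E * mu (cylinder x0 m))%E ->
    exists2 z, cylinder x0 m z & is_loop w r z (m + p).
  move=> mS /(lt_cyl _ _ mS)[y x0y [wy _]].
  have [z x0z zw] := con x0 w m p (leqnn p); exists z => //; split; last by rewrite zw.
  apply: cylinder_trans wy _; apply: (@sub_cylinder _ _ _ _ _ m).
    by rewrite /m; lia.
  exact: cylinder_trans (cylinder_sym x0y) x0z.
have [z xz zL] := loop _ _ mCB xB; have [z' xz' zL'] := loop _ _ mCnB x'B.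
have [L LL [y [y' [[zy zy'] [yL yL'] cy cy']]]] := HL _ _ _ zL zL'.
set s := (m + p + L)%N in yL yL' cy cy'.
have shrink x0 z0 y0 S : measurable S -> cylinder x0 m z0 -> cylinder z0 (m + p + r) y0 ->
    (mu (cylinder x0 m `\` S) <= eta%:E * mu (cylinder x0 m))%E ->
    (mu (cylinder y0 (s + r) `\` S) <= (eta / dm)%:E * mu (cylinder y0 (s + r)))%E.
  move=> mS x0z0 z0y0 x0S.
  have x0y0 : cylinder x0 m y0.
    by apply: cylinder_trans x0z0 _; apply: sub_cylinder z0y0; lia.
  apply: (@le_trans _ _ (mu (cylinder x0 m `\` S))).
    apply: le_mu; [exact: measurableD|exact: measurableD|move=> v [y0v nSv]; split=> //].
    apply: cylinder_trans x0y0 _; apply: sub_cylinder y0v; rewrite /s; lia.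
  apply: le_trans x0S _; have := dP x0 m (p + (L + r))%N y0 x0y0.
  have -> : (m + (p + (L + r)) = s + r)%N by rewrite /s; lia.
  have [a a0 ->] := finm _ (mcyl x0 m); have [a' a'0 ->] := finm _ (mcyl y0 (s + r)%N).
  rewrite -!EFinM !lee_fin -mulrA => da; rewrite ler_pM2l// ler_pdivlMl//.
  by apply: le_trans da; rewrite ler_wpM2r// dmP.
have yB := shrink _ _ _ _ mCB xz zy xB.
have yB' := shrink _ _ _ _ mCnB xz' zy' x'B.
have [yy' _] := swap_loop y yL yL'.
have th v : cylinder y (s + r) v -> cylinder y' (s + r) (swap_word y y' s v).
  by have [_] := swap_loop v yL yL'; apply.
have th' v : cylinder y' (s + r) v -> cylinder y (s + r) (swap_word y y' s v).
  by have [_] := swap_loop v yL' yL; rewrite (swap_wordC yy'); apply.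
have mth S : measurable S -> measurable (swap_word y y' s @^-1` S).
  by move=> mS; rewrite -[X in measurable X]setTI; exact: (swap_word_measurable yy').
(* [c] is not bounded uniformly, but it enters the estimates for the two directions of the swap with
   opposite signs and cancels, leaving [E]. *)
pose c := birkhoff phi s y - birkhoff phi s y'.
have HVs u v : cylinder u (s + r) v -> birkhoff phi s u - birkhoff phi s v <= V.
  by move=> uv; apply: HV; apply: sub_cylinder uv; exact: leq_addr.
have HVs' u v : cylinder u (s + r) v -> birkhoff phi s v - birkhoff phi s u <= V.
  by move=> /cylinder_sym; exact: HVs.
set Q' := cylinder y' (s + r) `\` _ in yB'.
set Q := cylinder y (s + r) `\` _ in yB.
have mQ : measurable Q by exact: measurableD.
have mQ' : measurable Q' by exact: measurableD.
pose T := cylinder y (s + r) `&` swap_word y y' s @^-1` Q'.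
have mT : measurable T by apply: measurableI => //; exact: mth.
have TQ' : (mu T <= (expR (c + 2 * V))%:E * mu Q')%E.
  apply: le_trans (swap_measure_le mu_phi (c := c + 2 * V) yy' mT _) _.
    move=> v [yv _]; have := HVs' _ _ yv; have := HVs _ _ (th _ yv); rewrite /c; lra.
  rewrite lee_wpmul2l ?lee_fin ?expR_ge0//; apply: le_mu => //; first exact: mth.
  by move=> v [_]; rewrite /= swap_wordK.
have yy : (mu (cylinder y' (s + r)) <= (expR (2 * V - c))%:E * mu (cylinder y (s + r)))%E.
  apply: le_trans (swap_measure_le mu_phi (c := 2 * V - c) yy' (mcyl _ _) _) _.
    move=> v yv; have := HVs' _ _ yv; have := HVs _ _ (th' _ yv); rewrite /c; lra.
  rewrite lee_wpmul2l ?lee_fin ?expR_ge0//; apply: le_mu => //; first exact: mth.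
  by move=> v /th'; rewrite swap_wordK.
have bad := central_swap_invariant yL yL' cy cy'.
set Bad := _ `&` _ in bad.
have mBad : measurable Bad.
  by apply: measurableI; [exact: measurableI|apply: mth; exact: measurableC].
(* A point of this cylinder outside [Q] lies in [B]; its image lies either in [B], so that the point
   is in [T], or outside [B], so that it is in the null set [Bad]. *)
have : (mu (cylinder y (s + r)) <= mu Q + mu T)%E.
  rewrite -[leRHS]adde0 -bad; apply: (@le_trans _ _ (mu (Q `|` T `|` Bad))).
    apply: le_mu => //; first by apply: measurableU => //; exact: measurableU.
    move=> v yv; have [[wv Bv]|nv] := pselect ((cylinder w r `&` B) v); last by left; left.
    have [Btv|nBtv] := pselect (B (swap_word y y' s v)); last by right.
    by left; right; split=> //; split; [exact: th|move=> []].
  apply: le_trans (measureU2 _ _ _) _ => //; first exact: measurableU.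
  by rewrite leeD2r//; exact: measureU2.
have := cylinder_gt0 phi_sv mu_phi aperA y (s + r).
move: TQ' yy yB yB'.
have [a a0 ->] := finm _ (mcyl y (s + r)%N); have [a' a'0 ->] := finm _ (mcyl y' (s + r)%N).
have [q q0 ->] := finm _ mQ; have [q' q'0 ->] := finm _ mQ'; have [t t0 ->] := finm _ mT.
rewrite -!EFinM -EFinD !lee_fin lte_fin => tq' a'a qa q'a' a_gt0 aqt.
have k0 : 0 <= eta / dm by rewrite divr_ge0// ltW.
move: (eta / dm) k0 etadm qa q'a' => k k0 kE qa q'a'.
have tE : t <= k * E * a.
  apply: le_trans tq' _.
  have -> : E = expR (c + 2 * V) * expR (2 * V - c).
    by rewrite -expRD /E; congr expR; ring.
  rewrite mulrCA -mulrA ler_wpM2l ?expR_ge0//; apply: le_trans q'a' _.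
  by rewrite -mulrA ler_wpM2l.
have : a <= 2^-1 * a.
  apply: le_trans aqt _; apply: (@le_trans _ _ (k * (1 + E) * a)); last first.
    by rewrite ler_wpM2r.
  by rewrite mulrDr mulr1 mulrDl lerD.
by rewrite -subr_ge0; lra.
Qed.


End local_ergodicity.

(** * Global ergodicity *)

Lemma finite_range_continuous n (A : 'M[bool]_n.+1) (irrA : irreducible_mx A)
    (T : choiceType) (f : sft irrA -> T) r :
  (forall x y, cylinder x r y -> f y = f x) ->
  continuous (f : sft irrA -> discrete_topology T).
Proof.
move=> fr x U /nbhs_singleton Ux; apply: filterS (nbhs_cylinder x r) => y /fr /= ->.
exact: Ux.
Qed.

Section skew_relations.
Context n (A : 'M[bool]_n.+1) (irrA : irreducible_mx A) (R : realType).
Variables (phi : sft irrA -> R) (mu : probability (sft irrA) R).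
Hypotheses (phi_sv : summable_variation phi) (mu_phi : gibbs_measure phi mu).
Hypothesis aperA : aperiodic_mx A.
Variable G : groupType.
Implicit Types (x y z w : sft irrA) (psi : sft irrA -> G) (B : set (sft irrA)).

Lemma skew_relation_refl psi x : skew_relation psi (x, x).
Proof. by apply/skew_relationP; exists 0%N. Qed.

Lemma skew_relation_sym psi x y : skew_relation psi (x, y) -> skew_relation psi (y, x).
Proof. by move=> /skew_relationP[N [? ?]]; apply/skew_relationP; exists N. Qed.

Lemma skew_relation_trans psi x y z :
  skew_relation psi (x, y) -> skew_relation psi (y, z) -> skew_relation psi (x, z).
Proof.
move=> /skew_relationP[N [xy pxy]] /skew_relationP[M [yz pyz]].
apply/skew_relationP; exists (N + M)%N; split.
  by rewrite addnC iterD xy -iterD addnC iterD yz -iterD addnC.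
transitivity (psi_prod psi (N + M) y); first by rewrite !psi_prodD pxy xy.
by rewrite [(N + M)%N]addnC !psi_prodD pyz yz.
Qed.

Lemma skew_saturation_measurable psi r B :
    (forall x y, cylinder x r y -> psi y = psi x) -> measurable B ->
  measurable (saturation (skew_relation psi) B).
Proof.
move=> psir mB.
have := @tail_saturation_measurable _ _ irrA
  (fun N x y => psi_prod psi N x = psi_prod psi N y) B _ mB.
rewrite (_ : [set p | _] = skew_relation psi).
  apply=> N; exists (N + r)%N => x x' y y' xx' yy'.
  by rewrite (psi_prod_finite_range psir xx') (psi_prod_finite_range psir yy').
by apply/seteqP; split=> -[x y] /skew_relationP.
Qed.

Lemma skew_quasi_invariant psi r : (forall x y, cylinder x r y -> psi y = psi x) ->
  quasi_invariant (skew_relation psi) mu.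
Proof.
move=> psir B mB B0; have [qi _] := mu_phi.
apply/eqP; rewrite eq_le measure_ge0 andbT -(qi _ mB B0); apply: le_mu.
- exact: skew_saturation_measurable psir _.
- exact: gibbs_saturation_measurable.
- by move=> y [x Bx [Rxy _]]; exists x.
Qed.

(** Turns one equivalent pair into a whole cylinder of them: the products up to time [N] read only
    [N + r] coordinates, so swapping words of that length preserves their equality. *)
Lemma skew_swap_word psi r x y : (forall x y, cylinder x r y -> psi y = psi x) ->
    skew_relation psi (x, y) ->
  exists2 M, (r <= M)%N & sft_coord x M = sft_coord y M /\
    forall z, cylinder x M.+1 z -> skew_relation psi (z, swap_word x y M z).
Proof.
move=> psir /skew_relationP[N [xy pxy]].
have xyk k : (N <= k)%N -> sft_coord x k = sft_coord y k.
  by move=> Nk; rewrite -(subnKC Nk) -!sft_coord_iter xy.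
have xyNr := xyk _ (leq_addr r N); exists (N + r)%N; first exact: leq_addl.
split=> // z xz; have yz := cylinder_swap_l xyNr xz.
have sub (u v : sft irrA) : cylinder u (N + r).+1 v -> cylinder u (N + r) v.
  exact: sub_cylinder.
apply/skew_relationP; exists N; split; last first.
  by rewrite (psi_prod_finite_range psir (sub _ _ xz))
    (psi_prod_finite_range psir (sub _ _ yz)).
apply: sft_coordP => k; rewrite !sft_coord_iter; have [kr|rk] := ltnP k r.+1.
  by rewrite xz ?yz ?xyk ?leq_addr//; lia.
have -> : (N + k = N + r + (k - r))%N by lia.
by rewrite -!sft_coord_iter iter_swap_word.
Qed.

Lemma null_of_cylinders B r : measurable B ->
  (forall w, mu (cylinder w r `&` B) = 0%E) -> mu B = 0%E.
Proof.
move=> mB B0.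
pose g x : {ffun 'I_r -> 'I_n.+1} := [ffun k : 'I_r => sft_coord x k].
have gcyl x : g @^-1` [set g x] = cylinder x r.
  apply/seteqP; split=> y.
    by move=> /= /ffunP gu k km; have := gu (Ordinal km); rewrite !ffunE.
  by move=> xy; apply/ffunP => k; rewrite !ffunE xy.
have mg i : measurable (g @^-1` [set i]).
  have [->//|/set0P[x xi]] := eqVneq (g @^-1` [set i]) set0.
  by rewrite -xi gcyl; exact: cylinder_measurable.
apply/eqP; rewrite eq_le measure_ge0 andbT.
have := @mu_le_card_fibers _ _ _ _ mu _ B g 0%E (lexx _) mB mg.
rewrite mule0; apply=> i.
have [->|/set0P[x [_ <-]]] := eqVneq (B `&` g @^-1` [set i]) set0.
  by rewrite measure0.
by rewrite gcyl setIC B0.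
Qed.

(* [psi'] is cohomologous to [psi] by a function of the first [r] coordinates,
   so that the two relations coincide within each cylinder of length [r]. *)
Lemma ergodic_of_linked psi psi' r r' : finite_conjugacy_classes G -> (0 < r)%N ->
    (forall x y, cylinder x r y -> psi y = psi x) ->
    (forall x y, cylinder x r' y -> psi' y = psi' x) ->
    (forall x y, cylinder x r y -> skew_relation psi (x, y) ->
      skew_relation psi' (x, y)) ->
    (forall w w', exists x y, [/\ cylinder w r x, cylinder w' r y &
      skew_relation psi' (x, y)]) ->
  ergodic (skew_relation psi') mu.
Proof.
move=> fcG r0 psir psi'r local link; split; first exact: skew_quasi_invariant psi'r.
move=> B0 mB0; set B := saturation _ B0.
have mB : measurable B by exact: skew_saturation_measurable psi'r mB0.
have mnB : measurable (~` B) by exact: measurableC.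
have Binv x y : skew_relation psi' (x, y) -> B x -> B y.
  by move=> xy [z B0z zx]; exists z => //; exact: skew_relation_trans xy.
have dich w : mu (cylinder w r `&` B) = 0%E \/ mu (cylinder w r `&` ~` B) = 0%E.
  apply: (local_ergodicity phi_sv mu_phi aperA r0 psir mB) => // x y wx wy Sxy.
  by apply: Binv; apply: local Sxy; exact: cylinder_trans (cylinder_sym wx) wy.
have [|B_gt0] := pselect (mu B = 0%E); first by left.
right; have [w wB] : exists w, mu (cylinder w r `&` B) <> 0%E.
  by apply: contrapT => /forallNP nw; apply: B_gt0; apply: null_of_cylinders => // w; apply: contrapT; exact: nw.
have wnB : mu (cylinder w r `&` ~` B) = 0%E by have [] := dich w.
apply: (null_of_cylinders (r := r)) => // w'.
have [w'B|//] := dich w'.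
(* The swap along the linked pair transports the nullity of [B] in the cylinder of [w'] to a
   subcylinder of that of [w], where the complement of [B] is null as well; this contradicts
   positivity of cylinders. *)
have [x [y [wx w'y Sxy]]] := link w w'.
have [M0 M00 HM] := birkhoff_oscillation phi_sv.
pose rr := maxn r r'.
have psi'rr u v : cylinder u rr v -> psi' v = psi' u.
  by move=> uv; apply: psi'r; apply: sub_cylinder uv; exact: leq_maxr.
have [M rM [xyM SM]] := skew_swap_word psi'rr Sxy.
have rM1 : (r <= M.+1)%N by move: rM; rewrite /rr; lia.
have wxM : cylinder x M.+1 `<=` cylinder w r.
  by move=> z xz; apply: cylinder_trans wx _; exact: sub_cylinder xz.
have w'yM : cylinder y M.+1 `<=` cylinder w' r.
  by move=> z yz; apply: cylinder_trans w'y _; exact: sub_cylinder yz.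
have mcyl u k : measurable (cylinder u k) by exact: cylinder_measurable.
have mxB : measurable (cylinder x M.+1 `&` B) by exact: measurableI.
have xB : mu (cylinder x M.+1 `&` B) = 0%E.
  apply/eqP; rewrite eq_le measure_ge0 andbT.
  apply: le_trans (swap_measure_le mu_phi (c := M%:R * M0) xyM mxB _) _.
    by move=> z _; exact: HM.
  rewrite -(mule0 (expR (M%:R * M0))%:E) lee_wpmul2l ?lee_fin ?expR_ge0// -w'B.
  apply: le_mu; [|exact: measurableI|].
    by rewrite -[X in measurable X]setTI; exact: (swap_word_measurable xyM).
  move=> z [xz Bz]; rewrite -(swap_wordK xyM z); split.
    by apply: w'yM; exact: cylinder_swap_l.
  by apply: Binv Bz; exact: SM.
have := cylinder_gt0 phi_sv mu_phi aperA x M.+1.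
suff -> : mu (cylinder x M.+1) = 0%E by rewrite ltxx.
apply/eqP; rewrite eq_le measure_ge0 andbT.
apply: (@le_trans _ _ (mu ((cylinder x M.+1 `&` B) `|` (cylinder w r `&` ~` B)))).
  apply: le_mu => //; first by apply: measurableU => //; do ?exact: measurableI.
  move=> z xz; have [Bz|Bz] := pselect (B z); [by left|right; split=> //].
  exact: wxM.
apply: le_trans (measureU2 _ _ _) _ => //; do ?exact: measurableI.
have le0 (u : \bar R) : u = 0%E -> (u <= 0)%E by move=> ->.
by rewrite -[leRHS]adde0; apply: leeD; apply: le0; [exact: xB|exact: wnB].
Qed.

(** The saturation of a cylinder has positive measure, hence is conull. A point in all of these
    countably many saturations has a class meeting every cylinder. *)
Lemma ergodic_transitive psi r : (forall x y, cylinder x r y -> psi y = psi x) ->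
  ergodic (skew_relation psi) mu -> topologically_transitive (skew_relation psi).
Proof.
move=> psir [_ erg].
pose S w k := saturation (skew_relation psi) (cylinder w k).
have mS w k : measurable (S w k).
  by apply: skew_saturation_measurable psir _; exact: cylinder_measurable.
have S0 w k : mu (~` S w k) = 0%E.
  have [Sk0|//] := erg (cylinder w k) (cylinder_measurable w k).
  have := cylinder_gt0 phi_sv mu_phi aperA w k.
  rewrite ltNge -Sk0 (le_mu mu _ (mS w k))//; first exact: cylinder_measurable.
  by move=> x wx; exists x => //; exact: skew_relation_refl.
pose rep (s : seq 'I_n.+1) := xget point [set x : sft irrA | sft_word x (size s) = s].
pose F k := if unpickle k is Some s then ~` S (rep s) (size s) else set0.
have nF : mu.-negligible (\bigcup_k F k).
  apply: negligible_bigcup => k; rewrite /F; case: unpickle => [s|]; last exact: negligible_set0.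
  by apply/negligibleP; [exact: measurableC|exact: S0].
have [x xF] : exists x, ~ (\bigcup_k F k) x.
  apply: contrapT => /forallNP allF.
  have : mu.-negligible [set: sft irrA].
    by apply: negligibleS nF => x _; apply: contrapT; exact: allF.
  move=> /(negligibleP _ measurableT) mu0.
  by have := @probability_setT _ _ _ mu; rewrite mu0 => /eqP; rewrite eq_sym onee_eq0.
exists x => U [y Uy] oU; have /open_sftP/(_ _ Uy)[k kU] := oU.
have : S (rep (sft_word y k)) (size (sft_word y k)) x.
  apply: contrapT => nS; apply: xF; exists (pickle (sft_word y k)) => //.
  by rewrite /F pickleK.
have sk : size (sft_word y k) = k by rewrite size_map size_iota.
have yrep : sft_word (rep (sft_word y k)) k = sft_word y k.
  pose W := [set x : sft irrA | sft_word x (size (sft_word y k)) = sft_word y k].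
  have : W (rep (sft_word y k)) by apply: (@xgetI _ _ W y); rewrite /W/= sk.
  by rewrite /W/= sk.
rewrite sk => -[z zk zx]; exists z; split; last exact: skew_relation_sym.
by apply: kU; apply: cylinder_trans zk; exact/sft_word_cylinder.
Qed.

End skew_relations.

(** * Cohomologous maps and the proof of the theorem *)

Section coboundary.
Context n (A : 'M[bool]_n.+1) (irrA : irreducible_mx A) (G : groupType).
Variables (psi h : sft irrA -> G).
Local Open Scope group_scope.

Definition cohomologous x : G := h x * psi x * (h (sft_shift x))^-1.

Lemma psi_prod_cohomologous N x : psi_prod cohomologous N x =
  h x * psi_prod psi N x * (h (iter N sft_shift x))^-1.
Proof.
elim: N => [|N IHN]; first by rewrite /psi_prod !big_geq// mulg1 mulgV.
rewrite -addn1 !psi_prodD IHN /psi_prod !big_nat1 /cohomologous/=.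
by rewrite -!mulgA mulKg addn1.
Qed.

End coboundary.

Theorem theorem4p3 (R : realType) (n : nat) (A : 'M[bool]_n.+1)
    (irrA : irreducible_mx A) (aperA : aperiodic_mx A)
    (phi : sft irrA -> R) (phi_sv : summable_variation phi)
    (G : groupType) (G_countable : countable [set: G])
    (G_fc : finite_conjugacy_classes G)
    (mu : probability (sft irrA) R) (mu_phi : gibbs_measure phi mu)
    (psi : sft irrA -> G)
    (psi_cont : continuous (psi : sft irrA -> discrete_topology G)) :
  (exists2 h : sft irrA -> G,
     continuous (h : sft irrA -> discrete_topology G) &
     ergodic
       (skew_relation (fun x => (h x * psi x * (h (sft_shift x))^-1)%g)) mu) /\
  (ergodic (skew_relation psi) mu <->
   topologically_transitive (skew_relation psi)).
Proof.
have [r0 psir0] := continuous_finite_range psi_cont; pose r := r0.+1.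
have psir x y : cylinder x r y -> psi y = psi x.
  by move=> xy; apply: psir0; exact: sub_cylinder xy.
split; last first.
  split; first exact: (ergodic_transitive phi_sv mu_phi aperA psir).
  move=> [x xdense]; apply: (ergodic_of_linked phi_sv mu_phi aperA G_fc _ psir psir) => //.
  have hit w : exists2 y, cylinder w r y & skew_relation psi (x, y).
    have [||y [wy xy]] := xdense (cylinder w r); first by exists w.
      exact: finite_range_open (@finite_range_cylinder _ _ _ _ _).
    by exists y.
  move=> w w'; have [y wy xy] := hit w; have [y' wy' xy'] := hit w'.
  by exists y, y'; split=> //; exact: skew_relation_trans (skew_relation_sym xy) xy'.
have [p con] := connect_cylinder irrA aperA.
pose w0 : sft irrA := point.
(* The connecting word depends on the first [r] coordinates only. *)
pose f x := xget point [set a | cylinder x r a /\ iter (r + p) sft_shift a = w0].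
have fP x : cylinder x r (f x) /\ iter (r + p) sft_shift (f x) = w0.
  have [z xz zw0] := con x w0 r p (leqnn p).
  exact: (@xgetI _ point [set a | cylinder x r a /\ iter (r + p) sft_shift a = w0] z).
(* Since [h (f x) = h x], the [psi']-product along the connecting word of [f x] reduces to the
   inverse of [h w0], the same for all [x]; this links all cylinders. *)
pose h x := (psi_prod psi (r + p) (f x))^-1%g.
have hr x y : cylinder x r y -> h y = h x.
  by move=> xy; rewrite /h /f (cylinder_eq xy).
exists h; first exact: finite_range_continuous hr.
(* The range grows by one because [cohomologous] also evaluates [h] at the shifted point. *)
apply: (ergodic_of_linked (psi := psi) (psi' := cohomologous psi h) (r := r) (r' := r.+1)
  phi_sv mu_phi aperA) => //.
- move=> x y xy; rewrite /cohomologous (psir x y) ?(hr x y); try exact: sub_cylinder xy.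
  congr (_ * _^-1)%g; apply: hr.
  by have := @cylinder_iter _ _ irrA x y 1 r; apply.
- move=> x y xy /skew_relationP[N [xyN pxy]]; apply/skew_relationP; exists N.
  by split=> //; rewrite !psi_prod_cohomologous pxy xyN (hr x y xy).
move=> w w'; have [[wf fw0] [wf' fw0']] := (fP w, fP w').
exists (f w), (f w'); split=> //; apply/skew_relationP; exists (r + p)%N.
rewrite fw0 fw0' !psi_prod_cohomologous fw0 fw0' (hr _ _ wf) (hr _ _ wf').
by rewrite /h !mulVg.
Qed.
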